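(* Fix a real number $\beta>-1$. Let $\phi$ be an analytic self-map of $\mathbb{D}$ whose Denjoy–Wolff point $\omega$ lies on the unit circle $\mathbb{T}$. If $\lambda$ is an eigenvalue of the composition operator $C_\phi:A^2_\beta\to A^2_\beta$, $C_\phi f=f\circ\phi$, having a cyclic function as a corresponding eigenvector, then $C_\phi-\lambda I$ has dense range in $A^2_\beta$.
   Context: $\mathbb{D}$ is the open unit disc and $\mathbb{T}$ the unit circle. For $\beta>-1$, $A^2_\beta$ is the Hilbert space of analytic functions $f(z)=\sum_{n\ge0}\widehat f(n)z^n$ on $\mathbb{D}$ with inner product $\langle f,g\rangle=\sum_{n\ge0}\frac{n!\,\Gamma(2+\beta)}{\Gamma(n+2+\beta)}\widehat f(n)\overline{\widehat g(n)}$ (equivalently the $L^2$ inner product with respect to $(\beta+1)(1-|z|^2)^\beta dA(z)$, $dA$ normalized area measure); every composition operator $C_\phi$ with $\phi$ an analytic self-map of $\mathbb{D}$ is bounded on it. A function $f\in A^2_\beta$ is cyclic if its polynomial multiples $\{pf\}$ are dense in $A^2_\beta$. If an analytic self-map $\phi$ of $\mathbb{D}$ is not an elliptic automorphism (an automorphism of $\mathbb{D}$ with a fixed point in $\mathbb{D}$), there is a unique $\omega\in\overline{\mathbb{D}}$ with $\lim_{n\to\infty}\phi^{[n]}(z)=\omega$ for all $z\in\mathbb{D}$, where $\phi^{[n]}$ is the $n$-th iterate; $\omega$ is the Denjoy–Wolff point of $\phi$. *)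

(* Defs.v *)
From Stdlib Require Import Reals List.
From Coquelicot Require Import Coquelicot.
Open Scope R_scope.

Definition in_disc (z : C) : Prop := Cmod z < 1.

Definition has_coeffs (f : C -> C) (a : nat -> C) : Prop :=
  forall z : C, in_disc z ->
    is_series (K := C_AbsRing) (V := C_NormedModule)
      (fun n => (a n * Cpow z n)%C) (f z).

Definition analytic_on_disc (f : C -> C) : Prop := exists a, has_coeffs f a.

Definition analytic_selfmap (phi : C -> C) : Prop :=
  analytic_on_disc phi /\ forall z, in_disc z -> in_disc (phi z).

(* Weight of the A^2_beta inner product:
   bweight beta n = n! Gamma(2+beta) / Gamma(n+2+beta)
                  = prod_{k=0}^{n-1} (k+1)/(k+2+beta). *)
Fixpoint bweight (beta : R) (n : nat) : R :=
  match n with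
  | O => 1
  | S m => bweight beta m * ((INR m + 1) / (INR m + 2 + beta))
  end.

Definition in_A2 (beta : R) (f : C -> C) : Prop :=
  exists a, has_coeffs f a /\
    ex_series (fun n => bweight beta n * (Cmod (a n))^2).

(* ||f - g||_{A^2_beta} < eps, where f, g are analytic on D
   (Taylor coefficients are unique, so the existential is harmless). *)
Definition A2_dist_lt (beta : R) (f g : C -> C) (eps : R) : Prop :=
  exists (a b : nat -> C) (s : R),
    has_coeffs f a /\ has_coeffs g b /\
    is_series (fun n => bweight beta n * (Cmod (a n - b n)%C)^2) s /\
    s < eps ^ 2.

Definition peval (l : list C) (z : C) : C :=
  fold_right (fun c acc => (c + z * acc)%C) (RtoC 0) l.

Definition cyclic_A2 (beta : R) (f : C -> C) : Prop :=
  in_A2 beta f /\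
  forall h, in_A2 beta h -> forall eps, 0 < eps ->
    exists p : list C, A2_dist_lt beta (fun z => (peval p z * f z)%C) h eps.

Definition DW_point (phi : C -> C) (omega : C) : Prop :=
  forall z, in_disc z ->
    filterlim (fun n => Nat.iter n phi z) eventually (locally omega).

(* Main.v *)
Require Import Defs.
From Stdlib Require Import Reals List Arith Lra Lia IndefiniteDescription.
From Coquelicot Require Import Coquelicot.
Open Scope R_scope.

(** If u is bounded and analytic, then C_phi (u f) - lambda u f = lambda f (u o phi - u);
    taking u = p o phi^[k] and summing over k, the range of C_phi - lambda contains
    f (p o phi^[m] - p) for every polynomial p.  When p(omega) = 0, the functions
    p o phi^[m] are bounded and tend to 0 pointwise, so f p lies in the closure of the
    range.  For an arbitrary polynomial p, the polynomial p (1 - (conj(omega) z)^n)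
    vanishes at omega, and f p (conj(omega) z)^n tends to 0 in norm; hence the closure
    contains f p, and f is cyclic.

    Both limits rest on the fact that multiplication by u is bounded by sup |u| on
    A^2_beta.  On sections of the coefficient sequence this is the corresponding Hardy
    space inequality, from Parseval on roots of unity, and the weight is decreasing, so
    summation by parts carries it over to A^2_beta without area integrals. *)

(** * Complex sequences and finite sums *)

(** Bounded pointwise convergence to 0 gives norm convergence only because [bweight beta] tends to
    0, and this uses [beta > -1]: for a constant weight (the Hardy space) the powers z^n keep norm
    1. Pointwise decay controls each single Taylor coefficient, boundedness controls the Hardy sum
    of all of them, and the small weight makes the remote ones negligible. The sup norms of p o
    phi^[m] need not tend to 0, so multiplication by them is null only strongly, on each fixed f.
    Dividing by lambda requires lambda nonzero: point evaluations are bounded, so a cyclic f has no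
    zero in the disc, whereas lambda = 0 would force f(phi(0)) = 0. The obstacle throughout is that
    analytic means having a power series at 0. Cauchy estimates come from the Hardy inequality, and
    analyticity of p o phi^[k] from a convergence theorem for bounded sequences, in place of contour
    integrals. *)

Definition Csum (a : nat -> C) (n : nat) : C := @sum_n C_AbelianMonoid a n.

(** Phrased through the real sequence of distances, so that the limit theory of real sequences
    applies directly; [Ccv_filterlim] identifies it with filter convergence. *)
Definition Ccv (u : nat -> C) (l : C) : Prop :=
  is_lim_seq (fun n => Cmod (u n - l)%C) 0.

Lemma Csum_0 a : Csum a 0 = a O.
Proof. exact (sum_O a). Qed.

Lemma Csum_S a n : Csum a (S n) = (Csum a n + a (S n))%C.
Proof. exact (sum_Sn a n). Qed.

Lemma Csum_ext_loc a b n :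
  (forall k, (k <= n)%nat -> a k = b k) -> Csum a n = Csum b n.
Proof. exact (sum_n_ext_loc a b n). Qed.

Lemma Csum_plus a b n : Csum (fun k => (a k + b k)%C) n = (Csum a n + Csum b n)%C.
Proof. exact (sum_n_plus a b n). Qed.

Lemma Csum_scal c a n : Csum (fun k => (c * a k)%C) n = (c * Csum a n)%C.
Proof. exact (sum_n_mult_l (K := C_Ring) c a n). Qed.

Lemma Csum_switch (u : nat -> nat -> C) m n :
  Csum (fun i => Csum (u i) n) m = Csum (fun j => Csum (fun i => u i j) m) n.
Proof. exact (sum_n_switch u m n). Qed.

Lemma Csum_conj a n : Cconj (Csum a n) = Csum (fun k => Cconj (a k)) n.
Proof.
  induction n as [|n IH].
  - rewrite !Csum_0; reflexivity.
  - rewrite !Csum_S, <- IH, Cplus_conj; reflexivity.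
Qed.

Lemma Csum_Re a n : Re (Csum a n) = sum_n (fun k => Re (a k)) n.
Proof.
  induction n as [|n IH].
  - rewrite Csum_0, sum_O; reflexivity.
  - rewrite Csum_S, sum_Sn, <- IH; reflexivity.
Qed.

Lemma Csum_Im a n : Im (Csum a n) = sum_n (fun k => Im (a k)) n.
Proof.
  induction n as [|n IH].
  - rewrite Csum_0, sum_O; reflexivity.
  - rewrite Csum_S, sum_Sn, <- IH; reflexivity.
Qed.

Lemma Csum_RtoC (a : nat -> R) n : Csum (fun k => RtoC (a k)) n = RtoC (sum_n a n).
Proof.
  induction n as [|n IH].
  - rewrite Csum_0, sum_O; reflexivity.
  - rewrite Csum_S, sum_Sn, IH, <- RtoC_plus; reflexivity.
Qed.

Lemma Csum_delta (a : nat -> C) n k :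
  (k <= n)%nat -> (forall j, (j <= n)%nat -> j <> k -> a j = RtoC 0) ->
  Csum a n = a k.
Proof.
  revert k; induction n as [|n IH]; intros k Hk Ha.
  - replace k with O by lia. apply Csum_0.
  - rewrite Csum_S. destruct (Nat.eq_dec k (S n)) as [->|Hne].
    + assert (E : Csum a n = RtoC 0).
      { rewrite (Csum_ext_loc a (fun _ => (RtoC 0 * RtoC 0)%C)).
        - rewrite Csum_scal; ring.
        - intros j Hj; rewrite Ha by lia; ring. }
      rewrite E; ring.
    + rewrite (IH k) by (try lia; intros; apply Ha; lia).
      rewrite (Ha (S n)) by lia; ring.
Qed.

Lemma Cmod_Csum a n : Cmod (Csum a n) <= sum_n (fun k => Cmod (a k)) n.
Proof.
  induction n as [|n IH].
  - rewrite Csum_0, sum_O; apply Rle_refl.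
  - rewrite Csum_S, sum_Sn. eapply Rle_trans; [apply Cmod_triangle|].
    apply Rplus_le_compat_r, IH.
Qed.

Lemma sum_n_le_loc (a b : nat -> R) n :
  (forall k, (k <= n)%nat -> a k <= b k) -> sum_n a n <= sum_n b n.
Proof. intros H; rewrite !sum_n_Reals; apply sum_Rle; exact H. Qed.

Lemma sum_n_nonneg (a : nat -> R) n : (forall k, 0 <= a k) -> 0 <= sum_n a n.
Proof. intros H; rewrite sum_n_Reals; apply cond_pos_sum; exact H. Qed.

Lemma sum_n_incr (a : nat -> R) n m :
  (forall k, 0 <= a k) -> (n <= m)%nat -> sum_n a n <= sum_n a m.
Proof.
  intros H Hnm; induction Hnm as [|m Hnm IH]; [apply Rle_refl|].
  rewrite sum_Sn. specialize (H (S m)). unfold plus; simpl. lra.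
Qed.

Lemma sum_n_scal (c : R) a n : sum_n (fun k => c * a k) n = c * sum_n a n.
Proof. exact (sum_n_mult_l (K := R_Ring) c a n). Qed.

Lemma sum_n_le_Series (a : nat -> R) n :
  (forall k, 0 <= a k) -> ex_series a -> sum_n a n <= Series a.
Proof.
  intros H Ha.
  apply (is_lim_seq_incr_compare (sum_n a)).
  - apply Series_correct in Ha. exact Ha.
  - intros k; apply sum_n_incr; [exact H|lia].
Qed.

Lemma ex_series_bounded (a : nat -> R) B :
  (forall k, 0 <= a k) -> (forall n, sum_n a n <= B) ->
  exists s, is_series a s /\ s <= B.
Proof.
  intros H HB.
  destruct (ex_finite_lim_seq_incr (sum_n a) B) as [s Hs].
  - intros n; apply sum_n_incr; [exact H|lia].
  - exact HB.
  - exists s; split; [exact Hs|].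
    apply (is_lim_seq_le (sum_n a) (fun _ => B) s B HB Hs (is_lim_seq_const B)).
Qed.

Lemma Ccv_filterlim (u : nat -> C) (l : C) :
  filterlim u eventually (locally (T := C_UniformSpace) l) <-> Ccv u l.
Proof.
  unfold Ccv. rewrite <- is_lim_seq_spec.
  rewrite (filterlim_locally_ball_norm (K := C_AbsRing) (U := C_NormedModule)).
  split; intros H eps; generalize (H eps); unfold eventually;
    intros [N HN]; exists N; intros n Hn; specialize (HN n Hn).
  - unfold ball_norm in HN. change (Cmod (u n - l)%C < eps) in HN.
    rewrite Rminus_0_r, Rabs_pos_eq by apply Cmod_ge_0. exact HN.
  - change (Cmod (u n - l)%C < eps).
    rewrite Rminus_0_r, Rabs_pos_eq in HN by apply Cmod_ge_0. exact HN.
Qed.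

Lemma is_series_Ccv (a : nat -> C) (l : C) :
  is_series (K := C_AbsRing) (V := C_NormedModule) a l <-> Ccv (Csum a) l.
Proof. rewrite <- Ccv_filterlim. reflexivity. Qed.

Lemma Ccv_squeeze (u : nat -> C) l (v : nat -> R) :
  (forall n, Cmod (u n - l)%C <= v n) -> is_lim_seq v 0 -> Ccv u l.
Proof.
  intros H Hv. apply is_lim_seq_le_le with (fun _ => 0) v.
  - intros n; split; [apply Cmod_ge_0|apply H].
  - apply is_lim_seq_const.
  - exact Hv.
Qed.

Lemma Ccv_plus u v l m : Ccv u l -> Ccv v m -> Ccv (fun n => (u n + v n)%C) (l + m)%C.
Proof.
  intros Hu Hv. apply Ccv_squeeze with (fun n => Cmod (u n - l)%C + Cmod (v n - m)%C).
  - intros n. replace (u n + v n - (l + m))%C with ((u n - l) + (v n - m))%C by ring.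
    apply Cmod_triangle.
  - replace (Finite 0) with (Finite (0 + 0)) by (f_equal; ring).
    apply is_lim_seq_plus'; assumption.
Qed.

Lemma Ccv_scal c u l : Ccv u l -> Ccv (fun n => (c * u n)%C) (c * l)%C.
Proof.
  intros Hu. apply Ccv_squeeze with (fun n => Cmod c * Cmod (u n - l)%C).
  - intros n. replace (c * u n - c * l)%C with (c * (u n - l))%C by ring.
    rewrite Cmod_mult; apply Rle_refl.
  - replace (Finite 0) with (Rbar_mult (Cmod c) 0) by (simpl; f_equal; ring).
    apply is_lim_seq_scal_l, Hu.
Qed.

Lemma Ccv_ext u v l : (forall n, u n = v n) -> Ccv u l -> Ccv v l.
Proof. intros E; apply is_lim_seq_ext; intros n; rewrite E; reflexivity. Qed.

Lemma im_le_Cmod c : Rabs (Im c) <= Cmod c.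
Proof. eapply Rle_trans; [apply Rmax_r|apply Rmax_Cmod]. Qed.

Lemma Cmod_le_Re_Im c : Cmod c <= Rabs (Re c) + Rabs (Im c).
Proof.
  apply Rsqr_incr_0; [|apply Cmod_ge_0|
    apply Rplus_le_le_0_compat; apply Rabs_pos].
  rewrite !Rsqr_pow2, Cmod2_alt.
  rewrite <- (pow2_abs (Re c)), <- (pow2_abs (Im c)).
  generalize (Rabs_pos (Re c)) (Rabs_pos (Im c)); intros; nra.
Qed.

Lemma Ccv_Re_Im u l :
  Ccv u l <-> is_lim_seq (fun n => Re (u n)) (Re l) /\ is_lim_seq (fun n => Im (u n)) (Im l).
Proof.
  split.
  - intros H; split.
    + apply is_lim_seq_spec; intros eps.
      apply is_lim_seq_spec in H; destruct (H eps) as [N HN]; exists N; intros n Hn.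
      specialize (HN n Hn). rewrite Rminus_0_r, Rabs_pos_eq in HN by apply Cmod_ge_0.
      eapply Rle_lt_trans; [|exact HN]. apply (re_le_Cmod (u n - l)%C).
    + apply is_lim_seq_spec; intros eps.
      apply is_lim_seq_spec in H; destruct (H eps) as [N HN]; exists N; intros n Hn.
      specialize (HN n Hn). rewrite Rminus_0_r, Rabs_pos_eq in HN by apply Cmod_ge_0.
      eapply Rle_lt_trans; [|exact HN]. apply (im_le_Cmod (u n - l)%C).
  - intros [H1 H2].
    apply Ccv_squeeze with (fun n => Rabs (Re (u n) - Re l) + Rabs (Im (u n) - Im l)).
    + intros n; apply (Cmod_le_Re_Im (u n - l)%C).
    + replace (Finite 0) with (Finite (0 + 0)) by (f_equal; ring).
      apply is_lim_seq_plus'.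
      * rewrite <- Rabs_R0. apply (is_lim_seq_abs _ (Finite 0)).
        replace 0 with (Re l - Re l) by ring.
        apply is_lim_seq_minus'; [exact H1|apply is_lim_seq_const].
      * rewrite <- Rabs_R0. apply (is_lim_seq_abs _ (Finite 0)).
        replace 0 with (Im l - Im l) by ring.
        apply is_lim_seq_minus'; [exact H2|apply is_lim_seq_const].
Qed.

(** * Cauchy products of complex series *)

Definition conv (a b : nat -> C) (n : nat) : C :=
  Csum (fun k => (a k * b (n - k)%nat)%C) n.

(** The product expands into real and imaginary parts, so the Cauchy product theorem for absolutely
    convergent real series is used four times. *)
Lemma Cseries_mult a b la lb :
  Ccv (Csum a) la -> Ccv (Csum b) lb ->
  ex_series (fun n => Cmod (a n)) -> ex_series (fun n => Cmod (b n)) ->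
  Ccv (Csum (conv a b)) (la * lb)%C.
Proof.
  intros Ha Hb Aa Ab.
  assert (abs : forall (c : nat -> C) (p : C -> R), (forall z, Rabs (p z) <= Cmod z) ->
     ex_series (fun n => Cmod (c n)) -> ex_series (fun n => Rabs (p (c n)))).
  { intros c p Hp Hc.
    apply (ex_series_le (K := R_AbsRing) (V := R_CompleteNormedModule) _ (fun n => Cmod (c n)));
      [|exact Hc].
    intros n. change (Rabs (Rabs (p (c n))) <= Cmod (c n)).
    rewrite Rabs_Rabsolu. apply Hp. }
  assert (ser : forall (c : nat -> C) l, Ccv (Csum c) l ->
     is_series (fun n => Re (c n)) (Re l) /\ is_series (fun n => Im (c n)) (Im l)).
  { intros c l Hc. apply Ccv_Re_Im in Hc; destruct Hc as [H1 H2]. split.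
    - refine (is_lim_seq_ext (fun n => Re (Csum c n)) _ (Re l) _ H1).
      intros n; apply Csum_Re.
    - refine (is_lim_seq_ext (fun n => Im (Csum c n)) _ (Im l) _ H2).
      intros n; apply Csum_Im. }
  destruct (ser a la Ha) as [Ha1 Ha2], (ser b lb Hb) as [Hb1 Hb2].
  pose proof (abs a Re re_le_Cmod Aa) as A1. pose proof (abs a Im im_le_Cmod Aa) as A2.
  pose proof (abs b Re re_le_Cmod Ab) as B1. pose proof (abs b Im im_le_Cmod Ab) as B2.
  apply Ccv_Re_Im; split.
  - apply is_lim_seq_ext with (sum_n (fun n => minus
      (sum_f_R0 (fun k => Re (a k) * Re (b (n - k)%nat)) n)
      (sum_f_R0 (fun k => Im (a k) * Im (b (n - k)%nat)) n))).
    { intros n; rewrite Csum_Re. apply sum_n_ext; intros m.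
      unfold conv; rewrite Csum_Re, sum_n_Reals.
      change minus with Rminus. rewrite <- minus_sum. reflexivity. }
    exact (is_series_minus (K := R_AbsRing) (V := R_NormedModule) _ _ _ _
      (is_series_mult _ _ _ _ Ha1 Hb1 A1 B1) (is_series_mult _ _ _ _ Ha2 Hb2 A2 B2)).
  - apply is_lim_seq_ext with (sum_n (fun n => plus
      (sum_f_R0 (fun k => Re (a k) * Im (b (n - k)%nat)) n)
      (sum_f_R0 (fun k => Im (a k) * Re (b (n - k)%nat)) n))).
    { intros n; rewrite Csum_Im. apply sum_n_ext; intros m.
      unfold conv; rewrite Csum_Im, sum_n_Reals.
      change plus with Rplus. rewrite <- sum_plus. reflexivity. }
    exact (is_series_plus (K := R_AbsRing) (V := R_NormedModule) _ _ _ _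
      (is_series_mult _ _ _ _ Ha1 Hb2 A1 B2) (is_series_mult _ _ _ _ Ha2 Hb1 A2 B1)).
Qed.

(** * Parseval's identity on roots of unity *)

Definition cis (t : R) : C := (cos t, sin t).

Lemma cis_plus s t : cis (s + t) = (cis s * cis t)%C.
Proof.
  unfold cis, Cmult; simpl. rewrite cos_plus, sin_plus. f_equal; ring.
Qed.

Lemma Cmod_cis t : Cmod (cis t) = 1.
Proof.
  unfold Cmod, cis; simpl. rewrite !Rmult_1_r.
  generalize (sin2_cos2 t); unfold Rsqr; intros H.
  replace (cos t * cos t + sin t * sin t) with 1 by lra. apply sqrt_1.
Qed.

Lemma cis_0 : cis 0 = RtoC 1.
Proof. unfold cis; rewrite cos_0, sin_0; reflexivity. Qed.

Lemma cis_conj t : Cconj (cis t) = cis (- t).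
Proof. unfold cis, Cconj; simpl; rewrite cos_neg, sin_neg; reflexivity. Qed.

Lemma cis_pow t n : (cis t ^ n)%C = cis (INR n * t).
Proof.
  induction n as [|n IH].
  - simpl; rewrite Rmult_0_l, cis_0; reflexivity.
  - rewrite Cpow_S, IH, <- cis_plus, S_INR. f_equal; ring.
Qed.

Lemma cis_2PI_INR k : cis (2 * PI * INR k) = RtoC 1.
Proof.
  rewrite <- cis_0. unfold cis.
  replace (2 * PI * INR k) with (0 + 2 * INR k * PI) by ring.
  rewrite cos_period, sin_period; reflexivity.
Qed.

(** By cos x = 1 - 2 sin^2(x/2), since sin is positive on (0, PI); the absolute value covers both
    signs of a difference of exponents. *)
Lemma cis_neq_1 x : 0 < Rabs x < 2 * PI -> cis x <> RtoC 1.
Proof.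
  intros [H1 H2] E. apply (f_equal fst) in E; simpl in E.
  assert (E' : cos (2 * (Rabs x / 2)) = 1).
  { replace (2 * (Rabs x / 2)) with (Rabs x) by field.
    unfold Rabs; destruct (Rcase_abs x); rewrite ?cos_neg; exact E. }
  rewrite cos_2a_sin in E'.
  assert (0 < sin (Rabs x / 2)) by (apply sin_gt_0; lra).
  nra.
Qed.

Lemma Csum_geom w m : (Csum (fun j => w ^ j) m * (w - 1))%C = (w ^ S m - 1)%C.
Proof.
  induction m as [|m IH].
  - rewrite Csum_0; simpl; ring.
  - rewrite Csum_S, (Cpow_S w (S m)), Cmult_plus_distr_r, IH; ring.
Qed.

(** There are [S m] of these roots, numbered from 0 to [m], exactly as many as the coefficients of a
    polynomial of degree at most [m]. *)
Definition root_of_unity (m j : nat) : C := cis (2 * PI * INR j / INR (S m)).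

(** The terms are the powers of w = [cis x] and w^(m+1) = 1, so the geometric sum vanishes unless w
    = 1; since |k - l| < m + 1, that happens only for k = l. *)
Lemma roots_orthogonal m k l : (k <= m)%nat -> (l <= m)%nat ->
  Csum (fun j => (root_of_unity m j ^ k * Cconj (root_of_unity m j ^ l))%C) m
  = if Nat.eq_dec k l then RtoC (INR (S m)) else RtoC 0.
Proof.
  intros Hk Hl.
  assert (HN : 0 < INR (S m)) by (apply lt_0_INR; lia).
  set (x := 2 * PI * (INR k - INR l) / INR (S m)).
  rewrite (Csum_ext_loc _ (fun j => (cis x ^ j)%C)).
  2:{ intros j _. unfold root_of_unity. rewrite !cis_pow, cis_conj, <- cis_plus.
      f_equal. unfold x; field; lra. }
  destruct (Nat.eq_dec k l) as [->|Hne].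
  - replace (cis x) with (RtoC 1).
    + rewrite (Csum_ext_loc _ (fun _ => RtoC 1)) by (intros; apply Cpow_1_l).
      rewrite Csum_RtoC, sum_n_const, Rmult_1_r; reflexivity.
    + unfold x. replace (2 * PI * (INR l - INR l) / INR (S m)) with 0 by (field; lra).
      symmetry; apply cis_0.
  - assert (Hx : cis x <> RtoC 1).
    { apply cis_neq_1.
      assert (Hd : 1 <= Rabs (INR k - INR l) < INR (S m)).
      { assert (0 <= INR k) by apply pos_INR. assert (0 <= INR l) by apply pos_INR.
        assert (INR k < INR (S m)) by (apply lt_INR; lia).
        assert (INR l < INR (S m)) by (apply lt_INR; lia).
        destruct (Nat.lt_ge_cases k l) as [Hlt|Hge].
        - apply le_INR in Hlt; rewrite S_INR in Hlt.
          rewrite Rabs_left by lra. lra.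
        - assert (Hlt : (S l <= k)%nat) by lia.
          apply le_INR in Hlt; rewrite S_INR in Hlt.
          rewrite Rabs_pos_eq by lra. lra. }
      generalize PI_RGT_0; intros HP.
      assert (E : Rabs x = 2 * PI * (Rabs (INR k - INR l) / INR (S m))).
      { unfold x, Rdiv. rewrite !Rabs_mult, Rabs_inv, (Rabs_pos_eq 2), (Rabs_pos_eq PI),
          (Rabs_pos_eq (INR (S m))) by lra. ring. }
      rewrite E.
      assert (0 < Rabs (INR k - INR l) / INR (S m) < 1).
      { split; [apply Rdiv_lt_0_compat; lra|].
        apply Rmult_lt_reg_r with (INR (S m)); [lra|]. field_simplify; lra. }
      nra. }
    assert (G : (Csum (fun j => cis x ^ j) m * (cis x - 1) = 0)%C).
    { rewrite Csum_geom, cis_pow.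
      replace (cis (INR (S m) * x)) with (RtoC 1); [ring|].
      replace (INR (S m) * x) with (2 * PI * INR k + - (2 * PI * INR l))
        by (unfold x; field; lra).
      rewrite cis_plus, <- cis_conj, !cis_2PI_INR.
      unfold Cconj, Cmult, RtoC; simpl; f_equal; ring. }
    assert (Hw : (cis x - 1)%C <> RtoC 0).
    { intros E. apply Hx. replace (cis x) with (cis x - 1 + 1)%C by ring. rewrite E; ring. }
    replace (Csum (fun j => cis x ^ j) m)%C
      with (Csum (fun j => cis x ^ j) m * (cis x - 1) / (cis x - 1))%C by (field; exact Hw).
    rewrite G. field; exact Hw.
Qed.

Lemma Csum_mult_conj (x : nat -> C) m :
  RtoC (Cmod (Csum x m) ^ 2) =
  Csum (fun k => Csum (fun l => (x k * Cconj (x l))%C) m) m.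
Proof.
  rewrite Cmod2_conj, Csum_conj.
  rewrite Cmult_comm, <- Csum_scal.
  apply Csum_ext_loc; intros k _. rewrite Cmult_comm, <- Csum_scal. reflexivity.
Qed.

(** Squared moduli are expanded as double sums; after summation over the roots, orthogonality leaves
    only the diagonal. *)
Lemma parseval_roots (d : nat -> C) m :
  sum_n (fun j => Cmod (Csum (fun k => (d k * root_of_unity m j ^ k)%C) m) ^ 2) m
  = INR (S m) * sum_n (fun k => Cmod (d k) ^ 2) m.
Proof.
  apply RtoC_inj. rewrite <- Csum_RtoC.
  rewrite (Csum_ext_loc _ (fun j => Csum (fun k => Csum (fun l =>
    (d k * Cconj (d l) *
     (root_of_unity m j ^ k * Cconj (root_of_unity m j ^ l)))%C) m) m)).
  2:{ intros j _. rewrite Csum_mult_conj.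
      apply Csum_ext_loc; intros k _; apply Csum_ext_loc; intros l _.
      rewrite Cmult_conj; ring. }
  rewrite Csum_switch, <- sum_n_scal, <- Csum_RtoC.
  apply Csum_ext_loc; intros k Hk. rewrite Csum_switch.
  rewrite (Csum_delta _ m k Hk).
  - rewrite Csum_scal, roots_orthogonal by assumption.
    destruct (Nat.eq_dec k k) as [_|H]; [|congruence].
    rewrite RtoC_mult, Cmod2_conj. ring.
  - intros l Hl Hlk. rewrite Csum_scal, roots_orthogonal by assumption.
    destruct (Nat.eq_dec k l) as [E|_]; [congruence|ring].
Qed.

(** * Power series on the disc *)

Lemma has_coeffs_Ccv F a : has_coeffs F a <->
  forall z, in_disc z -> Ccv (Csum (fun n => (a n * z ^ n)%C)) (F z).
Proof.
  unfold has_coeffs; split; intros H z Hz; apply is_series_Ccv, H, Hz.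
Qed.

Lemma has_coeffs_ext F G a b : has_coeffs F a ->
  (forall z, in_disc z -> F z = G z) -> (forall n, a n = b n) -> has_coeffs G b.
Proof.
  intros H E Eab. apply has_coeffs_Ccv; intros z Hz. rewrite <- E by exact Hz.
  apply Ccv_ext with (2 := proj1 (has_coeffs_Ccv F a) H z Hz).
  intros n; apply Csum_ext_loc; intros; rewrite Eab; reflexivity.
Qed.

Lemma has_coeffs_plus F G a b : has_coeffs F a -> has_coeffs G b ->
  has_coeffs (fun z => (F z + G z)%C) (fun n => (a n + b n)%C).
Proof.
  rewrite !has_coeffs_Ccv. intros Ha Hb z Hz.
  apply Ccv_ext with (2 := Ccv_plus _ _ _ _ (Ha z Hz) (Hb z Hz)).
  intros n. rewrite <- Csum_plus. apply Csum_ext_loc; intros; ring.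
Qed.

Lemma has_coeffs_scal c F a : has_coeffs F a ->
  has_coeffs (fun z => (c * F z)%C) (fun n => (c * a n)%C).
Proof.
  rewrite !has_coeffs_Ccv. intros Ha z Hz.
  apply Ccv_ext with (2 := Ccv_scal c _ _ (Ha z Hz)).
  intros n. rewrite <- Csum_scal. apply Csum_ext_loc; intros; ring.
Qed.

(** At the intermediate radius [s] the terms stay bounded because the series converges there; the
    ratio [r / s] < 1 then gives a geometric majorant. *)
Lemma coeffs_summable F a r : has_coeffs F a -> 0 <= r < 1 ->
  ex_series (fun n => Cmod (a n) * r ^ n).
Proof.
  intros Ha Hr. set (s := (r + 1) / 2).
  assert (Hs : 0 < s < 1 /\ r < s) by (unfold s; lra).
  assert (Hz : in_disc (RtoC s)).
  { unfold in_disc; rewrite Cmod_R, Rabs_pos_eq; lra. }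
  apply has_coeffs_Ccv with (z := RtoC s) in Ha; [|exact Hz].
  assert (HB : exists B, forall n, Cmod (a n) * s ^ n <= B).
  { destruct (filterlim_bounded (K := R_AbsRing) (V := R_NormedModule)
      (fun n => Cmod (Csum (fun k => (a k * RtoC s ^ k)%C) n - F (RtoC s))%C)) as [M HM].
    { exists 0; exact Ha. }
    (* A term is the difference of two consecutive partial sums, each within [M] of F(s); the extra
       modulus of F(s) covers n = 0, which has no predecessor. *)
    exists (2 * M + Cmod (F (RtoC s))).
    assert (HM' : forall n, Cmod (Csum (fun k => (a k * RtoC s ^ k)%C) n - F (RtoC s))%C <= M).
    { intros n. eapply Rle_trans; [|apply (HM n)]. apply Rle_abs. }
    assert (HM0 : 0 <= M) by (eapply Rle_trans; [apply Cmod_ge_0|apply (HM' O)]).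
    intros n.
    replace (Cmod (a n) * s ^ n) with (Cmod (a n * RtoC s ^ n)%C).
    2:{ rewrite Cmod_mult, Cmod_pow, Cmod_R, (Rabs_pos_eq s) by lra; reflexivity. }
    destruct n as [|n].
    - generalize (HM' O); rewrite Csum_0; intros H.
      replace (a O * RtoC s ^ 0)%C with ((a O * RtoC s ^ 0 - F (RtoC s)) + F (RtoC s))%C by ring.
      eapply Rle_trans; [apply Cmod_triangle|]. lra.
    - set (u := Csum (fun k => (a k * RtoC s ^ k)%C)) in *.
      replace (a (S n) * RtoC s ^ S n)%C
        with ((u (S n) - F (RtoC s)) + - (u n - F (RtoC s)))%C
        by (unfold u; rewrite Csum_S; ring).
      eapply Rle_trans; [apply Cmod_triangle|]. rewrite Cmod_opp.
      generalize (HM' n) (HM' (S n)) (Cmod_ge_0 (F (RtoC s))). lra. }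
  destruct HB as [B HB].
  apply (ex_series_le (K := R_AbsRing) (V := R_CompleteNormedModule) _ (fun n => B * (r / s) ^ n)).
  - intros n. change (Rabs (Cmod (a n) * r ^ n) <= B * (r / s) ^ n).
    assert (0 <= (r / s)) by (apply Rdiv_le_0_compat; lra).
    rewrite Rabs_pos_eq by (apply Rmult_le_pos; [apply Cmod_ge_0|apply pow_le; lra]).
    replace r with (s * (r / s)) at 1 by (field; lra).
    rewrite Rpow_mult_distr, <- Rmult_assoc.
    apply Rmult_le_compat_r; [apply pow_le; lra|apply HB].
  - apply (ex_series_scal_l (K := R_AbsRing) (V := R_NormedModule) B).
    apply ex_series_geom. rewrite Rabs_pos_eq by (apply Rdiv_le_0_compat; lra).
    apply Rmult_lt_reg_r with s; [lra|]. field_simplify; lra.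
Qed.

Lemma coeffs_abs_summable F a z : has_coeffs F a -> in_disc z ->
  ex_series (fun n => Cmod (a n * z ^ n)%C).
Proof.
  intros Ha Hz.
  apply ex_series_ext with (2 := coeffs_summable F a (Cmod z) Ha (conj (Cmod_ge_0 z) Hz)).
  intros n; rewrite Cmod_mult, Cmod_pow; reflexivity.
Qed.

Lemma has_coeffs_mult F G a b : has_coeffs F a -> has_coeffs G b ->
  has_coeffs (fun z => (F z * G z)%C) (conv a b).
Proof.
  intros Ha Hb; apply has_coeffs_Ccv; intros z Hz.
  apply Ccv_ext with (2 := Cseries_mult _ _ _ _
    (proj1 (has_coeffs_Ccv _ _) Ha z Hz) (proj1 (has_coeffs_Ccv _ _) Hb z Hz)
    (coeffs_abs_summable _ _ _ Ha Hz) (coeffs_abs_summable _ _ _ Hb Hz)).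
  intros n; apply Csum_ext_loc; intros k _. unfold conv.
  rewrite Cmult_comm, <- Csum_scal. apply Csum_ext_loc; intros j Hj.
  replace (z ^ k)%C with (z ^ j * z ^ (k - j))%C
    by (rewrite <- Cpow_add_r; f_equal; lia). ring.
Qed.

Definition truncate (n : nat) (a : nat -> C) (k : nat) : C :=
  if le_dec k n then a k else RtoC 0.

Lemma has_coeffs_truncate n a :
  has_coeffs (fun z => Csum (fun k => (a k * z ^ k)%C) n) (truncate n a).
Proof.
  apply has_coeffs_Ccv; intros z _.
  apply (is_lim_seq_ext_loc (fun _ => 0)); [|apply is_lim_seq_const].
  exists n; intros m Hm. induction Hm as [|m Hm IH].
  - rewrite (Csum_ext_loc _ (fun k => (a k * z ^ k)%C)).
    + unfold Cminus; rewrite Cplus_opp_r, Cmod_0; reflexivity.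
    + intros k Hk; unfold truncate; destruct (le_dec k n); [reflexivity|lia].
  - rewrite Csum_S. unfold truncate at 2.
    destruct (le_dec (S m) n); [lia|]. rewrite Cmult_0_l, Cplus_0_r. exact IH.
Qed.

Lemma has_coeffs_const c : has_coeffs (fun _ => c) (truncate 0 (fun _ => c)).
Proof.
  apply has_coeffs_ext with (1 := has_coeffs_truncate 0 (fun _ => c)).
  - intros z _; rewrite Csum_0; simpl; ring.
  - reflexivity.
Qed.

Lemma has_coeffs_id :
  has_coeffs (fun z => z) (truncate 1 (fun k => if Nat.eq_dec k 1 then RtoC 1 else RtoC 0)).
Proof.
  eapply has_coeffs_ext; [apply has_coeffs_truncate| |reflexivity].
  intros z _; cbv beta; rewrite Csum_S, Csum_0; simpl; ring.
Qed.

Lemma conv_truncate a b n k : (k <= n)%nat -> conv a (truncate n b) k = conv a b k.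
Proof.
  intros Hk; apply Csum_ext_loc; intros j Hj. unfold truncate.
  destruct (le_dec (k - j) n); [reflexivity|lia].
Qed.

(** * Bessel's inequality and multipliers *)

(* Bessel's inequality for |F| <= M |P| on the circle of radius r: Parseval is applied
   to the Taylor section of F of degree K >= n on the (K+1)-st roots of unity, which
   are too few to see any aliasing, and then K -> oo. *)
Lemma bessel_circle F c (a : nat -> C) M n r :
  has_coeffs F c -> 0 <= M -> 0 <= r < 1 ->
  (forall z, in_disc z -> Cmod (F z) <= M * Cmod (Csum (fun k => (a k * z ^ k)%C) n)) ->
  sum_n (fun k => (Cmod (c k) * r ^ k) ^ 2) n
  <= M ^ 2 * sum_n (fun k => (Cmod (a k) * r ^ k) ^ 2) n.
Proof.
  intros Hc HM Hr HF.
  set (x := fun k => Cmod (c k) * r ^ k).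
  assert (Hx : forall k, 0 <= x k)
    by (intros k; apply Rmult_le_pos; [apply Cmod_ge_0|apply pow_le; lra]).
  pose proof (coeffs_summable F c r Hc Hr) as Hsum. change (ex_series x) in Hsum.
  (* [eps K] bounds the error of the Taylor section of degree K on the whole circle, and [A] bounds
     the polynomial there; the error terms in [key] come from expanding (M |P| + eps)^2 with |P| <=
     A. *)
  set (eps := fun K => Series x - sum_n x K).
  set (A := sum_n (fun k => Cmod (a k)) n).
  assert (HA : 0 <= A) by (apply sum_n_nonneg; intros; apply Cmod_ge_0).
  assert (Heps0 : forall K, 0 <= eps K)
    by (intros K; generalize (sum_n_le_Series x K Hx Hsum); unfold eps; lra).
  assert (key : forall K, (n <= K)%nat ->
    sum_n (fun k => x k ^ 2) n <=
    M ^ 2 * sum_n (fun k => (Cmod (a k) * r ^ k) ^ 2) n + 2 * M * A * eps K + eps K ^ 2).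
  { intros K HK.
    set (zt := fun j => (RtoC r * root_of_unity K j)%C).
    assert (Hroot : forall j, Cmod (root_of_unity K j) = 1) by (intros; apply Cmod_cis).
    assert (Hmod : forall j, Cmod (zt j) = r).
    { intros j; unfold zt; rewrite Cmod_mult, Hroot, Cmod_R, Rabs_pos_eq by lra; ring. }
    assert (Hzt : forall j, in_disc (zt j))
      by (intros j; unfold in_disc; rewrite Hmod; lra).
    set (T := fun j => Csum (fun k => (c k * zt j ^ k)%C) K).
    set (P := fun j => Csum (fun k => (a k * zt j ^ k)%C) n).
    assert (HP : forall j, Cmod (P j) <= A).
    { intros j. eapply Rle_trans; [apply Cmod_Csum|].
      apply sum_n_le_loc; intros k _. rewrite Cmod_mult, Cmod_pow, Hmod.
      assert (0 <= r ^ k <= 1)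
        by (split; [apply pow_le; lra|rewrite <- (pow1 k); apply pow_incr; lra]).
      generalize (Cmod_ge_0 (a k)); nra. }
    assert (HT : forall j, Cmod (T j) <= M * Cmod (P j) + eps K).
    { intros j.
      (* The distance to the full sum is estimated through sections of degree L >= K, with L tending
         to infinity. *)
      assert (Hd : Cmod (T j - F (zt j))%C <= eps K).
      { rewrite <- (Rminus_0_r (Cmod (T j - F (zt j))%C)).
        refine (is_lim_seq_le_loc
          (fun L => Cmod (T j - F (zt j))%C
             - Cmod (Csum (fun k => (c k * zt j ^ k)%C) L - F (zt j))%C)
          (fun _ => eps K) (Cmod (T j - F (zt j))%C - 0) (eps K) _ _ _).
        - exists K; intros L HL.
          assert (Hd : Cmod (Csum (fun k => (c k * zt j ^ k)%C) L - T j)%C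
                       <= sum_n x L - sum_n x K).
          { induction HL as [|L HL IH].
            - unfold T, Cminus; rewrite Cplus_opp_r, Cmod_0; lra.
            - rewrite Csum_S, sum_Sn.
              replace (Csum (fun k => (c k * zt j ^ k)%C) L + c (S L) * zt j ^ S L - T j)%C
                with ((Csum (fun k => (c k * zt j ^ k)%C) L - T j) + c (S L) * zt j ^ S L)%C
                by ring.
              eapply Rle_trans; [apply Cmod_triangle|].
              rewrite Cmod_mult, Cmod_pow, Hmod.
              change plus with Rplus. unfold x at 2. simpl in *. lra. }
          replace (T j - F (zt j))%C
            with (- (Csum (fun k => (c k * zt j ^ k)%C) L - T j)
                  + (Csum (fun k => (c k * zt j ^ k)%C) L - F (zt j)))%C at 1 by ring.
          generalize (Cmod_triangle (- (Csum (fun k => (c k * zt j ^ k)%C) L - T j))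
            (Csum (fun k => (c k * zt j ^ k)%C) L - F (zt j))).
          rewrite Cmod_opp.
          generalize (sum_n_le_Series x L Hx Hsum). unfold eps. lra.
        - apply is_lim_seq_minus'; [apply is_lim_seq_const|].
          exact (proj1 (has_coeffs_Ccv F c) Hc (zt j) (Hzt j)).
        - apply is_lim_seq_const. }
      replace (T j) with ((T j - F (zt j)) + F (zt j))%C by ring.
      eapply Rle_trans; [apply Cmod_triangle|].
      generalize (HF (zt j) (Hzt j)); fold (P j). lra. }
    assert (HN : 0 < INR (S K)) by (apply lt_0_INR; lia).
    assert (ET : sum_n (fun j => Cmod (T j) ^ 2) K = INR (S K) * sum_n (fun k => x k ^ 2) K).
    { rewrite (sum_n_ext (fun k => x k ^ 2) (fun k => Cmod (c k * RtoC r ^ k)%C ^ 2)).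
      - rewrite <- parseval_roots. apply sum_n_ext; intros j.
        do 2 f_equal. apply Csum_ext_loc; intros k _. unfold zt.
        rewrite Cpow_mult_l; ring.
      - intros k; unfold x. rewrite Cmod_mult, Cmod_pow, Cmod_R, (Rabs_pos_eq r) by lra.
        reflexivity. }
    (* Padding with zero coefficients up to K lets the same roots compute the norm of the
       polynomial. *)
    assert (EP : sum_n (fun j => Cmod (P j) ^ 2) K
                 = INR (S K) * sum_n (fun k => (Cmod (a k) * r ^ k) ^ 2) n).
    { assert (E : forall (y z : nat -> R) L, (n <= L)%nat ->
        (forall k, (k <= n)%nat -> y k = z k) -> (forall k, (n < k)%nat -> y k = 0) ->
        sum_n y L = sum_n z n).
      { intros y z L HL H1 H2. induction HL as [|L HL IH].
        - apply sum_n_ext_loc; exact H1.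
        - rewrite sum_Sn, IH, H2 by lia. exact (Rplus_0_r _). }
      rewrite <- (E (fun k => Cmod (truncate n a k * RtoC r ^ k)%C ^ 2) _ K HK).
      - rewrite <- parseval_roots. apply sum_n_ext; intros j.
        do 2 f_equal. unfold P.
        transitivity (Csum (fun k => (truncate n a k * zt j ^ k)%C) K).
        + generalize (zt j) as w; clear - HK; intros w. induction HK as [|K HK IH].
          * apply Csum_ext_loc; intros k Hk; unfold truncate.
            destruct (le_dec k n); [reflexivity|lia].
          * rewrite Csum_S, <- IH. unfold truncate.
            destruct (le_dec (S K) n); [lia|ring].
        + apply Csum_ext_loc; intros k _. unfold zt. rewrite Cpow_mult_l; ring.
      - intros k Hk; unfold truncate; destruct (le_dec k n); [|lia].
        rewrite Cmod_mult, Cmod_pow, Cmod_R, (Rabs_pos_eq r) by lra; reflexivity.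
      - intros k Hk; unfold truncate; destruct (le_dec k n); [lia|].
        rewrite Cmult_0_l, Cmod_0; ring. }
    assert (Hle : sum_n (fun j => Cmod (T j) ^ 2) K <=
       sum_n (fun j => M ^ 2 * Cmod (P j) ^ 2 + (2 * M * A * eps K + eps K ^ 2)) K).
    { apply sum_n_le_loc; intros j _.
      generalize (HT j) (HP j) (Cmod_ge_0 (T j)) (Cmod_ge_0 (P j)) (Heps0 K); intros h1 h2 h3 h4 h5.
      apply Rle_trans with ((M * Cmod (P j) + eps K) ^ 2); [apply pow_incr; lra|].
      assert (0 <= M * eps K * (A - Cmod (P j)))
        by (repeat apply Rmult_le_pos; lra).
      nra. }
    rewrite (sum_n_plus (G := R_AbelianMonoid) (fun j => M ^ 2 * Cmod (P j) ^ 2)) in Hle.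
    rewrite sum_n_scal, sum_n_const, ET, EP in Hle.
    change plus with Rplus in Hle.
    assert (Hnn : sum_n (fun k => x k ^ 2) n <= sum_n (fun k => x k ^ 2) K)
      by (apply sum_n_incr; [intros; apply pow2_ge_0|exact HK]).
    eapply Rle_trans; [exact Hnn|].
    apply Rmult_le_reg_l with (INR (S K)); [exact HN|]. lra. }
  assert (Hlim : is_lim_seq eps 0).
  { unfold eps. replace 0 with (Series x - Series x) by ring.
    apply is_lim_seq_minus'; [apply is_lim_seq_const|].
    exact (Series_correct _ Hsum). }
  set (V := M ^ 2 * sum_n (fun k => (Cmod (a k) * r ^ k) ^ 2) n) in *.
  refine (is_lim_seq_le_loc (fun _ => sum_n (fun k => x k ^ 2) n)
    (fun K => V + 2 * M * A * eps K + eps K * eps K)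
    (sum_n (fun k => x k ^ 2) n) V _ _ _).
  - exists n; intros K HK. generalize (key K HK). simpl. lra.
  - apply is_lim_seq_const.
  - replace V with (V + 2 * M * A * 0 + 0 * 0) at 1 by ring.
    apply is_lim_seq_plus'; [apply is_lim_seq_plus'|apply is_lim_seq_mult'; exact Hlim].
    + apply is_lim_seq_const.
    + apply is_lim_seq_mult'; [apply is_lim_seq_const|exact Hlim].
Qed.

(** Radii tending to 1 that start at 0, so that every index gives an admissible radius. *)
Definition rho (i : nat) : R := 1 - / (INR i + 1).

Lemma rho_bounds i : 0 <= rho i < 1.
Proof.
  unfold rho. assert (0 <= INR i) by apply pos_INR.
  assert (0 < / (INR i + 1)) by (apply Rinv_0_lt_compat; lra).
  assert (/ (INR i + 1) <= 1) by (rewrite <- Rinv_1; apply Rinv_le_contravar; lra).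
  lra.
Qed.

Lemma rho_pow_lim k : is_lim_seq (fun i => rho i ^ k) 1.
Proof.
  assert (Hlim : is_lim_seq rho 1).
  { unfold rho. replace (Finite 1) with (Finite (1 - 0)) by (f_equal; ring).
    apply is_lim_seq_minus'; [apply is_lim_seq_const|].
    change (is_lim_seq (fun i => / (INR i + 1)) (Rbar_inv p_infty)).
    apply is_lim_seq_inv; [|discriminate].
    eapply is_lim_seq_plus; [apply is_lim_seq_INR|apply is_lim_seq_const|reflexivity]. }
  induction k as [|k IH]; [apply is_lim_seq_const|].
  simpl. replace 1 with (1 * 1) by ring. apply is_lim_seq_mult'; assumption.
Qed.

(** Both sides of [bessel_circle] are finite sums, hence continuous in the radius, which tends to 1
    along [rho]. *)
Lemma bessel_section F c (a : nat -> C) M n :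
  has_coeffs F c -> 0 <= M ->
  (forall z, in_disc z -> Cmod (F z) <= M * Cmod (Csum (fun k => (a k * z ^ k)%C) n)) ->
  sum_n (fun k => Cmod (c k) ^ 2) n <= M ^ 2 * sum_n (fun k => Cmod (a k) ^ 2) n.
Proof.
  intros Hc HM HF.
  assert (Hcont : forall b : nat -> C,
    is_lim_seq (fun i => sum_n (fun k => (Cmod (b k) * rho i ^ k) ^ 2) n)
      (sum_n (fun k => Cmod (b k) ^ 2) n)).
  { intros b.
    assert (Hp : forall k, is_lim_seq (fun i => (Cmod (b k) * rho i ^ k) ^ 2) (Cmod (b k) ^ 2)).
    { intros k.
      pose proof (rho_pow_lim k) as Hk.
      simpl. replace (Cmod (b k)) with (Cmod (b k) * 1) at 1 2 by ring.
      repeat apply is_lim_seq_mult'; try assumption; apply is_lim_seq_const. }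
    clear HF. induction n as [|m IH].
    - rewrite sum_O. eapply is_lim_seq_ext; [|exact (Hp O)]. intros i; rewrite sum_O; reflexivity.
    - rewrite sum_Sn.
      refine (is_lim_seq_ext _ _ _ _ (is_lim_seq_plus' _ _ _ _ IH (Hp (S m)))).
      intros i; rewrite sum_Sn; reflexivity. }
  refine (is_lim_seq_le _ _ _ _ _ (Hcont c)
    (is_lim_seq_mult' _ _ _ _ (is_lim_seq_const (M ^ 2)) (Hcont a))).
  intros i. apply (bessel_circle F c a M n (rho i) Hc HM (rho_bounds i) HF).
Qed.

(** Up to index n the product sees only the section of [a], and |U P| <= M |P| for the polynomial P
    with these coefficients. *)
Lemma multiplier_section U u (a : nat -> C) M n :
  has_coeffs U u -> 0 <= M -> (forall z, in_disc z -> Cmod (U z) <= M) ->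
  sum_n (fun k => Cmod (conv u a k) ^ 2) n <= M ^ 2 * sum_n (fun k => Cmod (a k) ^ 2) n.
Proof.
  intros Hu HM HU.
  rewrite (sum_n_ext_loc _ (fun k => Cmod (conv u (truncate n a) k) ^ 2)).
  2:{ intros k Hk; rewrite conv_truncate by exact Hk; reflexivity. }
  apply (bessel_section _ _ a M n (has_coeffs_mult _ _ _ _ Hu (has_coeffs_truncate n a)) HM).
  intros z Hz. rewrite Cmod_mult.
  apply Rmult_le_compat_r; [apply Cmod_ge_0|apply HU, Hz].
Qed.

Lemma hardy_section U u M n :
  has_coeffs U u -> 0 <= M -> (forall z, in_disc z -> Cmod (U z) <= M) ->
  sum_n (fun k => Cmod (u k) ^ 2) n <= M ^ 2.
Proof.
  intros Hu HM HU.
  set (one := fun k => if Nat.eq_dec k 0 then RtoC 1 else RtoC 0).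
  assert (E : forall m z, Csum (fun k => (one k * z ^ k)%C) m = RtoC 1).
  { intros m z. rewrite (Csum_delta _ m O); [unfold one; simpl; ring|lia|].
    intros j _ Hj; unfold one; destruct (Nat.eq_dec j 0); [lia|ring]. }
  assert (E2 : sum_n (fun k => Cmod (one k) ^ 2) n = 1).
  { clear. induction n as [|n IH].
    - rewrite sum_O; unfold one; simpl; rewrite Cmod_1; ring.
    - rewrite sum_Sn, IH; unfold one; simpl. rewrite Cmod_0.
      change plus with Rplus; simpl; ring. }
  rewrite <- (Rmult_1_r (M ^ 2)), <- E2.
  apply (bessel_section U u one M n Hu HM).
  intros z Hz. rewrite E, Cmod_1, Rmult_1_r. apply HU, Hz.
Qed.

(** The Cauchy estimate, read off from a single term of the Hardy sum. *)
Lemma coeff_le_bound U u M n :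
  has_coeffs U u -> 0 <= M -> (forall z, in_disc z -> Cmod (U z) <= M) ->
  Cmod (u n) <= M.
Proof.
  intros Hu HM HU. generalize (hardy_section U u M n Hu HM HU); intros H.
  assert (Cmod (u n) ^ 2 <= sum_n (fun k => Cmod (u k) ^ 2) n).
  { destruct n as [|n]; [rewrite sum_O; lra|]. rewrite sum_Sn.
    generalize (sum_n_nonneg (fun k => Cmod (u k) ^ 2) n (fun k => pow2_ge_0 _)).
    change plus with Rplus; lra. }
  generalize (Cmod_ge_0 (u n)); nra.
Qed.

(** * Bounded limits of analytic functions *)

Lemma Ccv_bound u l B N : Ccv u l -> (forall n, (N <= n)%nat -> Cmod (u n) <= B) ->
  Cmod l <= B.
Proof.
  intros Hu HB.
  refine (is_lim_seq_le_loc (fun _ => Cmod l) (fun n => B + Cmod (u n - l)%C)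
    (Cmod l) B _ (is_lim_seq_const _) _).
  - exists N; intros n Hn.
    replace l with (u n + - (u n - l))%C at 1 by ring.
    eapply Rle_trans; [apply Cmod_triangle|]. rewrite Cmod_opp.
    apply Rplus_le_compat_r, HB, Hn.
  - replace (Finite B) with (Finite (B + 0)) by (f_equal; ring).
    apply is_lim_seq_plus'; [apply is_lim_seq_const|exact Hu].
Qed.

Lemma Ccv_const l : Ccv (fun _ => l) l.
Proof.
  apply Ccv_squeeze with (fun _ => 0); [|apply is_lim_seq_const].
  intros _; unfold Cminus; rewrite Cplus_opp_r, Cmod_0; apply Rle_refl.
Qed.

Lemma Ccv_minus u v l m : Ccv u l -> Ccv v m -> Ccv (fun n => (u n - v n)%C) (l - m)%C.
Proof.
  intros Hu Hv.
  replace (l - m)%C with (l + - (1) * m)%C by ring.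
  apply Ccv_ext with (fun n => (u n + - (1) * v n)%C); [intros; ring|].
  apply Ccv_plus, Ccv_scal; assumption.
Qed.

Lemma Ccv_Csum (x : nat -> nat -> C) y L :
  (forall k, Ccv (fun n => x n k) (y k)) -> Ccv (fun n => Csum (x n) L) (Csum y L).
Proof.
  intros H; induction L as [|L IH].
  - rewrite Csum_0. apply Ccv_ext with (2 := H O). intros; rewrite Csum_0; reflexivity.
  - rewrite Csum_S. apply Ccv_ext with (2 := Ccv_plus _ _ _ _ IH (H (S L))).
    intros; rewrite Csum_S; reflexivity.
Qed.

Lemma taylor_tail U u M L z :
  has_coeffs U u -> (forall k, (L < k)%nat -> Cmod (u k) <= M) -> 0 <= M -> in_disc z ->
  Cmod (Csum (fun k => (u k * z ^ k)%C) L - U z)%C <= M * (Cmod z ^ S L / (1 - Cmod z)).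
Proof.
  intros Hu HM HM0 Hz. pose proof (Cmod_ge_0 z) as Hz0. unfold in_disc in Hz.
  set (s := Csum (fun k => (u k * z ^ k)%C)).
  replace (s L - U z)%C with (- (U z - s L))%C by ring. rewrite Cmod_opp.
  apply (Ccv_bound (fun n => (s n - s L)%C) _ _ L).
  - apply Ccv_minus; [apply (proj1 (has_coeffs_Ccv U u) Hu z Hz)|apply Ccv_const].
  - intros n Hn.
    (* The exact geometric sum is carried through the induction; the weaker bound of the conclusion
       would not close it. *)
    assert (H : Cmod (s n - s L)%C <= M * ((Cmod z ^ S L - Cmod z ^ S n) / (1 - Cmod z))).
    { induction Hn as [|n Hn IH].
      - unfold Cminus; rewrite Cplus_opp_r, Cmod_0, Rminus_diag. unfold Rdiv; lra.
      - unfold s at 1; rewrite Csum_S; fold s.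
        replace (s n + u (S n) * z ^ S n - s L)%C
          with ((s n - s L) + u (S n) * z ^ S n)%C by ring.
        eapply Rle_trans; [apply Cmod_triangle|]. rewrite Cmod_mult, Cmod_pow.
        apply Rle_trans with (M * ((Cmod z ^ S L - Cmod z ^ S n) / (1 - Cmod z))
                              + M * Cmod z ^ S n).
        + apply Rplus_le_compat; [exact IH|].
          apply Rmult_le_compat_r; [apply pow_le, Hz0|apply HM; lia].
        + apply Req_le. rewrite <- !tech_pow_Rmult. field. lra. }
    eapply Rle_trans; [exact H|]. apply Rmult_le_compat_l; [exact HM0|].
    apply Rmult_le_compat_r; [apply Rlt_le, Rinv_0_lt_compat; lra|].
    generalize (pow_le (Cmod z) (S n) Hz0); lra.
Qed.

(* The Taylor coefficients of a function bounded by M are controlled, one after the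
   other, by its values at small points r > 0, since the tail of the series after
   index k is O(r^(k+1)) with a constant depending only on M. *)
Lemma coeff_estimate M eps k : 0 <= M -> 0 < eps ->
  exists (l : list C) (delta : R), 0 < delta /\ (forall z, In z l -> in_disc z) /\
    forall U u, has_coeffs U u -> (forall z, in_disc z -> Cmod (U z) <= M) ->
      (forall z, In z l -> Cmod (U z) <= delta) ->
      forall j, (j < k)%nat -> Cmod (u j) <= eps.
Proof.
  intros HM. revert eps. induction k as [|k IH]; intros eps Heps.
  - exists nil, 1; split; [lra|split; [intros z []|intros; lia]].
  - set (r := eps / (eps + 2 * (M + 1))).
    assert (Hr : 0 < r < 1).
    { unfold r; split; [apply Rdiv_lt_0_compat; lra|].
      apply Rmult_lt_reg_r with (eps + 2 * (M + 1)); [lra|]. field_simplify; lra. }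
    assert (Hr' : M * (r / (1 - r)) <= eps / 2).
    { replace (r / (1 - r)) with (eps / (2 * (M + 1))) by (unfold r; field; lra).
      apply Rmult_le_reg_r with (2 * (M + 1)); [lra|]. field_simplify; nra. }
    assert (Hrk : 0 < r ^ k) by (apply pow_lt; lra).
    assert (Hk : 0 <= INR k) by apply pos_INR.
    (* The k lower coefficients together get a quarter of eps r^k and the value at r another
       quarter; with the tail this adds up to eps r^k. *)
    set (eps' := Rmin eps (eps * r ^ k / (4 * (INR k + 1)))).
    assert (Heps' : 0 < eps').
    { apply Rmin_glb_lt; [exact Heps|]. apply Rdiv_lt_0_compat; [|lra].
      apply Rmult_lt_0_compat; lra. }
    destruct (IH eps' Heps') as (l & delta & Hd & Hl & H).
    exists (RtoC r :: l), (Rmin delta (eps * r ^ k / 4)).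
    assert (Hrd : in_disc (RtoC r))
      by (unfold in_disc; rewrite Cmod_R, Rabs_pos_eq; lra).
    split; [apply Rmin_glb_lt; [exact Hd|]; nra|]. split.
    { intros z [<-|Hz]; [exact Hrd|apply Hl, Hz]. }
    intros U u Hu HU Hsmall j Hj.
    assert (Hlow : forall i, (i < k)%nat -> Cmod (u i) <= eps').
    { apply (H U u Hu HU). intros z Hz.
      eapply Rle_trans; [apply Hsmall; right; exact Hz|apply Rmin_l]. }
    destruct (Nat.eq_dec j k) as [->|Hne].
    2:{ eapply Rle_trans; [apply Hlow; lia|apply Rmin_l]. }
    set (x := fun i => (u i * RtoC r ^ i)%C).
    assert (Hx : forall i, Cmod (x i) = Cmod (u i) * r ^ i).
    { intros i; unfold x; rewrite Cmod_mult, Cmod_pow, Cmod_R, Rabs_pos_eq by lra; reflexivity. }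
    assert (Hsec : Cmod (Csum x k - x k)%C <= INR k * eps').
    { destruct k as [|m].
      - rewrite Csum_0; unfold Cminus; rewrite Cplus_opp_r, Cmod_0; simpl; lra.
      - rewrite Csum_S. replace (Csum x m + x (S m) - x (S m))%C with (Csum x m) by ring.
        eapply Rle_trans; [apply Cmod_Csum|].
        rewrite <- sum_n_const. apply sum_n_le_loc; intros i Hi.
        rewrite Hx. assert (0 <= r ^ i <= 1)
          by (split; [apply pow_le; lra|rewrite <- (pow1 i); apply pow_incr; lra]).
        generalize (Hlow i (le_n_S _ _ Hi)) (Cmod_ge_0 (u i)); nra. }
    assert (Htail : Cmod (Csum x k - U (RtoC r))%C <= r ^ k * (eps / 2)).
    { eapply Rle_trans.
      - apply (taylor_tail U u M k (RtoC r) Hu); [|exact HM|exact Hrd].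
        intros i _. apply (coeff_le_bound U u M i Hu HM HU).
      - rewrite Cmod_R, Rabs_pos_eq by lra. simpl. unfold Rdiv in *.
        generalize (Rmult_le_compat_l (r ^ k) _ _ (Rlt_le _ _ Hrk) Hr'). lra. }
    assert (HUr : Cmod (U (RtoC r)) <= eps * r ^ k / 4)
      by (eapply Rle_trans; [apply Hsmall; left; reflexivity|apply Rmin_r]).
    assert (Hk' : INR k * eps' <= eps * r ^ k / 4).
    { apply Rle_trans with (INR k * (eps * r ^ k / (4 * (INR k + 1)))).
      - apply Rmult_le_compat_l; [exact Hk|apply Rmin_r].
      - apply Rmult_le_reg_r with (4 * (INR k + 1)); [lra|].
        assert (0 < eps * r ^ k) by (apply Rmult_lt_0_compat; lra).
        field_simplify; [|lra]. lra. }
    apply Rmult_le_reg_r with (r ^ k); [exact Hrk|]. rewrite <- Hx.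
    replace (x k) with (- (Csum x k - x k) + (Csum x k - U (RtoC r)) + U (RtoC r))%C by ring.
    eapply Rle_trans; [apply Cmod_triangle|].
    generalize (Cmod_triangle (- (Csum x k - x k)) (Csum x k - U (RtoC r))).
    rewrite Cmod_opp. lra.
Qed.

(** Finitely many test points admit a common threshold, so pointwise convergence suffices to use
    [coeff_estimate]. *)
Lemma eventually_small_on_list (P : nat -> C -> Prop) (l : list C) :
  (forall z, In z l -> exists N, forall n, (N <= n)%nat -> P n z) ->
  exists N, forall n, (N <= n)%nat -> forall z, In z l -> P n z.
Proof.
  induction l as [|a l IH]; intros H.
  - exists O; intros n _ z [].
  - destruct IH as [N1 H1]; [intros z Hz; apply H; right; exact Hz|].
    destruct (H a (or_introl eq_refl)) as [N2 H2].
    exists (max N1 N2); intros n Hn z [<-|Hz]; [apply H2; lia|apply H1; [lia|exact Hz]].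
Qed.

Lemma Ccv_eventually u l eps : Ccv u l -> 0 < eps ->
  exists N, forall n, (N <= n)%nat -> Cmod (u n - l)%C <= eps.
Proof.
  intros H He. apply is_lim_seq_spec in H.
  destruct (H (mkposreal eps He)) as [N HN]. exists N; intros n Hn.
  specialize (HN n Hn). simpl in HN.
  rewrite Rminus_0_r, Rabs_pos_eq in HN by apply Cmod_ge_0. lra.
Qed.

Lemma coeffs_null (U : nat -> C -> C) M eps k :
  0 <= M -> (forall n z, in_disc z -> Cmod (U n z) <= M) ->
  (forall z, in_disc z -> Ccv (fun n => U n z) 0) -> 0 < eps ->
  exists N, forall n, (N <= n)%nat ->
    forall u, has_coeffs (U n) u -> forall j, (j < k)%nat -> Cmod (u j) <= eps.
Proof.
  intros HM HU Hlim He.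
  destruct (coeff_estimate M eps k HM He) as (l & delta & Hd & Hl & H).
  destruct (eventually_small_on_list (fun n z => Cmod (U n z) <= delta) l) as [N HN].
  { intros z Hz. destruct (Ccv_eventually _ _ _ (Hlim z (Hl z Hz)) Hd) as [N HN].
    exists N; intros n Hn. specialize (HN n Hn).
    replace (U n z) with (U n z - 0)%C by ring. exact HN. }
  exists N; intros n Hn u Hu. apply (H (U n) u Hu (HU n)), HN, Hn.
Qed.

(** The estimate is applied to U_n - U_m, which is analytic and bounded by M + M, rather than to U_n
    - V, since the analyticity of V is what is to be deduced; the coefficients thus form a Cauchy
    sequence. *)
Lemma coeffs_converge (U : nat -> C -> C) (u : nat -> nat -> C) (V : C -> C) M k :
  0 <= M -> (forall n, has_coeffs (U n) (u n)) ->
  (forall n z, in_disc z -> Cmod (U n z) <= M) ->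
  (forall z, in_disc z -> Ccv (fun n => U n z) (V z)) ->
  exists c, Ccv (fun n => u n k) c.
Proof.
  intros HM Hu HU Hlim.
  assert (Hcau : forall eps : posreal, exists N, forall n m, (N <= n)%nat -> (N <= m)%nat ->
    Cmod (u n k - u m k)%C < eps).
  { intros [eps He]; simpl.
    destruct (coeff_estimate (M + M) (eps / 2) (S k)) as (l & delta & Hd & Hl & H); [lra|lra|].
    destruct (eventually_small_on_list (fun n z => Cmod (U n z - V z)%C <= delta / 2) l)
      as [N HN].
    { intros z Hz. apply (Ccv_eventually _ _ _ (Hlim z (Hl z Hz))); lra. }
    exists N; intros n m Hn Hm.
    apply Rle_lt_trans with (eps / 2); [|lra].
    replace (u n k - u m k)%C with (u n k + - (1) * u m k)%C by ring.
    apply (H _ _ (has_coeffs_plus _ _ _ _ (Hu n) (has_coeffs_scal (- (1)) _ _ (Hu m))));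
      [| |lia].
    - intros z Hz. eapply Rle_trans; [apply Cmod_triangle|].
      rewrite Cmod_mult, Cmod_m1, Rmult_1_l. apply Rplus_le_compat; apply HU, Hz.
    - intros z Hz.
      replace (U n z + - (1) * U m z)%C with ((U n z - V z) + - (U m z - V z))%C by ring.
      eapply Rle_trans; [apply Cmod_triangle|]. rewrite Cmod_opp.
      generalize (HN n Hn z Hz) (HN m Hm z Hz); lra. }
  assert (Hre : ex_finite_lim_seq (fun n => Re (u n k))).
  { apply ex_lim_seq_cauchy_corr. intros eps. destruct (Hcau eps) as [N HN].
    exists N; intros n m Hn Hm. eapply Rle_lt_trans; [|apply (HN n m Hn Hm)].
    apply (re_le_Cmod (u n k - u m k)%C). }
  assert (Him : ex_finite_lim_seq (fun n => Im (u n k))).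
  { apply ex_lim_seq_cauchy_corr. intros eps. destruct (Hcau eps) as [N HN].
    exists N; intros n m Hn Hm. eapply Rle_lt_trans; [|apply (HN n m Hn Hm)].
    apply (im_le_Cmod (u n k - u m k)%C). }
  destruct Hre as [x Hx], Him as [y Hy]. exists (x, y).
  apply Ccv_Re_Im; split; assumption.
Qed.

Lemma Ccv_null_geom (z : C) B : in_disc z -> is_lim_seq (fun n => B * (Cmod z ^ n)) 0.
Proof.
  intros Hz. replace (Finite 0) with (Rbar_mult B 0) by (simpl; f_equal; ring).
  apply is_lim_seq_scal_l, is_lim_seq_geom.
  rewrite Rabs_pos_eq by apply Cmod_ge_0. exact Hz.
Qed.

(** A Vitali-type theorem: the limits of the coefficients are coefficients of [V], because at a
    fixed point the Taylor remainder of degree L is bounded uniformly in n and tends to 0 with L. *)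
Lemma bounded_limit_analytic (U : nat -> C -> C) (V : C -> C) M :
  0 <= M -> (forall n, analytic_on_disc (U n)) ->
  (forall n z, in_disc z -> Cmod (U n z) <= M) ->
  (forall z, in_disc z -> Ccv (fun n => U n z) (V z)) ->
  analytic_on_disc V.
Proof.
  intros HM Han HU Hlim.
  destruct (functional_choice (fun n a => has_coeffs (U n) a) Han) as [u Hu].
  destruct (functional_choice (fun k c => Ccv (fun n => u n k) c)) as [v Hv].
  { intros k; apply (coeffs_converge U u V M k HM Hu HU Hlim). }
  exists v. apply has_coeffs_Ccv; intros z Hz.
  apply Ccv_squeeze with (fun L => M * (Cmod z / (1 - Cmod z)) * Cmod z ^ L);
    [|apply Ccv_null_geom, Hz].
  intros L. unfold in_disc in Hz.
  replace (M * (Cmod z / (1 - Cmod z)) * Cmod z ^ L)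
    with (M * (Cmod z ^ S L / (1 - Cmod z))) by (simpl; field; lra).
  apply (Ccv_bound (fun n => (Csum (fun k => (u n k * z ^ k)%C) L - U n z)%C) _ _ O).
  - apply Ccv_minus; [|apply Hlim, Hz].
    apply (Ccv_Csum (fun n k => (u n k * z ^ k)%C)).
    intros k. rewrite Cmult_comm.
    apply Ccv_ext with (2 := Ccv_scal (z ^ k) _ _ (Hv k)). intros n; ring.
  - intros n _. apply (taylor_tail _ _ _ _ _ (Hu n)); [|exact HM|exact Hz].
    intros k _. apply (coeff_le_bound _ _ _ _ (Hu n) HM (HU n)).
Qed.

(** * Bounded analytic functions *)

Definition Hinf (U : C -> C) : Prop :=
  analytic_on_disc U /\ exists M, 0 <= M /\ forall z, in_disc z -> Cmod (U z) <= M.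

Lemma Hinf_const c : Hinf (fun _ => c).
Proof.
  split; [eexists; apply has_coeffs_const|].
  exists (Cmod c); split; [apply Cmod_ge_0|intros; apply Rle_refl].
Qed.

Lemma Hinf_id : Hinf (fun z => z).
Proof.
  split; [eexists; apply has_coeffs_id|].
  exists 1; split; [lra|intros z Hz; apply Rlt_le, Hz].
Qed.

Lemma Hinf_plus U V : Hinf U -> Hinf V -> Hinf (fun z => (U z + V z)%C).
Proof.
  intros [[u Hu] (M & HM0 & HM)] [[v Hv] (N & HN0 & HN)].
  split; [eexists; apply (has_coeffs_plus _ _ _ _ Hu Hv)|].
  exists (M + N); split; [lra|]. intros z Hz.
  eapply Rle_trans; [apply Cmod_triangle|]. generalize (HM z Hz) (HN z Hz); lra.
Qed.

Lemma Hinf_mult U V : Hinf U -> Hinf V -> Hinf (fun z => (U z * V z)%C).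
Proof.
  intros [[u Hu] (M & HM0 & HM)] [[v Hv] (N & HN0 & HN)].
  split; [eexists; apply (has_coeffs_mult _ _ _ _ Hu Hv)|].
  exists (M * N); split; [nra|]. intros z Hz. rewrite Cmod_mult.
  apply Rmult_le_compat; try apply Cmod_ge_0; [apply HM|apply HN]; exact Hz.
Qed.

Lemma Hinf_pow U n : Hinf U -> Hinf (fun z => (U z ^ n)%C).
Proof.
  intros HU; induction n as [|n IH]; [exact (Hinf_const 1)|].
  apply (Hinf_mult _ _ HU IH).
Qed.

Lemma Hinf_Csum (U : nat -> C -> C) n :
  (forall k, Hinf (U k)) -> Hinf (fun z => Csum (fun k => U k z) n).
Proof.
  intros HU; induction n as [|n IH].
  - destruct (HU O) as [[u Hu] (M & HM0 & HM)].
    split.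
    + exists u; apply has_coeffs_ext with (1 := Hu); [|reflexivity].
      intros; rewrite Csum_0; reflexivity.
    + exists M; split; [exact HM0|intros z Hz; rewrite Csum_0; apply HM, Hz].
  - destruct (Hinf_plus _ _ IH (HU (S n))) as [[u Hu] (M & HM0 & HM)].
    split.
    + exists u; apply has_coeffs_ext with (1 := Hu); [|reflexivity].
      intros; rewrite Csum_S; reflexivity.
    + exists M; split; [exact HM0|intros z Hz; rewrite Csum_S; apply HM, Hz].
Qed.

(** An eps/3 argument: the remainder bound at w serves all the points rho w, which are no farther
    from 0, and a fixed section is continuous. *)
Lemma radial_continuity F a w :
  has_coeffs F a -> (exists M, 0 <= M /\ forall k, Cmod (a k) <= M) -> in_disc w ->
  Ccv (fun i => F (RtoC (rho i) * w)%C) (F w).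
Proof.
  intros Ha (M & HM & HaM) Hw.
  apply is_lim_seq_spec; intros [eps He]; simpl.
  set (B := M * (Cmod w / (1 - Cmod w))).
  assert (Hnn : 0 < 1 - Cmod w) by (unfold in_disc in Hw; lra).
  pose proof (Cmod_ge_0 w) as Hw0.
  assert (HL : exists L, B * Cmod w ^ L < eps / 3).
  { pose proof (Ccv_null_geom w B Hw) as H. apply is_lim_seq_spec in H.
    assert (He3 : 0 < eps / 3) by lra.
    destruct (H (mkposreal _ He3)) as [N HN]. exists N. specialize (HN N (le_n N)).
    simpl in HN. rewrite Rminus_0_r in HN. eapply Rle_lt_trans; [apply Rle_abs|exact HN]. }
  destruct HL as [L HL].
  assert (Htail : forall i, Cmod (Csum (fun k => (a k * (RtoC (rho i) * w) ^ k)%C) L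
      - F (RtoC (rho i) * w))%C < eps / 3).
  { intros i. pose proof (rho_bounds i) as Hi.
    assert (Hm : Cmod (RtoC (rho i) * w)%C <= Cmod w).
    { rewrite Cmod_mult, Cmod_R, Rabs_pos_eq by lra. nra. }
    assert (Hd : in_disc (RtoC (rho i) * w)%C) by (unfold in_disc in *; lra).
    eapply Rle_lt_trans; [apply (taylor_tail F a M L _ Ha); [intros; apply HaM|exact HM|exact Hd]|].
    eapply Rle_lt_trans; [|exact HL].
    replace (B * Cmod w ^ L) with (M * (Cmod w ^ S L / (1 - Cmod w)))
      by (unfold B; simpl; field; lra).
    apply Rmult_le_compat_l; [exact HM|].
    apply Rmult_le_compat.
    - apply pow_le, Cmod_ge_0.
    - apply Rlt_le, Rinv_0_lt_compat. unfold in_disc in Hd; lra.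
    - apply pow_incr; split; [apply Cmod_ge_0|exact Hm].
    - apply Rinv_le_contravar; lra. }
  assert (Htail0 : Cmod (Csum (fun k => (a k * w ^ k)%C) L - F w)%C < eps / 3).
  { eapply Rle_lt_trans; [apply (taylor_tail F a M L _ Ha); [intros; apply HaM|exact HM|exact Hw]|].
    eapply Rle_lt_trans; [|exact HL]. apply Req_le; unfold B; simpl; field; lra. }
  assert (Hfin : Ccv (fun i => Csum (fun k => (a k * (RtoC (rho i) * w) ^ k)%C) L)
                   (Csum (fun k => (a k * w ^ k)%C) L)).
  { apply (Ccv_Csum (fun i k => (a k * (RtoC (rho i) * w) ^ k)%C)). intros k.
    replace (a k * w ^ k)%C with (a k * w ^ k * RtoC 1)%C by ring.
    apply Ccv_ext with (fun i => (a k * w ^ k * RtoC (rho i ^ k))%C).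
    { intros i. rewrite Cpow_mult_l, RtoC_pow; ring. }
    apply Ccv_scal. apply Ccv_Re_Im; split; [apply rho_pow_lim|apply is_lim_seq_const]. }
  assert (He3 : 0 < eps / 3) by lra.
  destruct (Ccv_eventually _ _ _ Hfin He3) as [N HN].
  exists N; intros i Hi. specialize (HN i Hi). specialize (Htail i).
  rewrite Rminus_0_r, Rabs_pos_eq by apply Cmod_ge_0.
  set (Si := Csum (fun k => (a k * (RtoC (rho i) * w) ^ k)%C) L) in *.
  set (S0 := Csum (fun k => (a k * w ^ k)%C) L) in *.
  replace (F (RtoC (rho i) * w) - F w)%C
    with (- (Si - F (RtoC (rho i) * w)) + ((Si - S0) + (S0 - F w)))%C by ring.
  eapply Rle_lt_trans; [apply Cmod_triangle|]. rewrite Cmod_opp.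
  generalize (Cmod_triangle (Si - S0) (S0 - F w)). lra.
Qed.

(* The Taylor sections of w |-> F (rho w) are bounded on the disc for each rho < 1, so
   F (rho phi) and then F o phi are bounded pointwise limits of analytic functions. *)
Lemma Hinf_comp F phi : Hinf F -> analytic_selfmap phi -> Hinf (fun z => F (phi z)).
Proof.
  intros [[a Ha] (M & HM & HF)] [Hphi Hself].
  assert (HaM : forall k, Cmod (a k) <= M)
    by (intros k; apply (coeff_le_bound F a M k Ha HM HF)).
  assert (Hphi' : Hinf phi).
  { split; [exact Hphi|]. exists 1; split; [lra|].
    intros z Hz; apply Rlt_le, Hself, Hz. }
  split; [|exists M; split; [exact HM|intros z Hz; apply HF, Hself, Hz]].
  assert (Hdil : forall i z, in_disc z -> in_disc (RtoC (rho i) * z)%C).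
  { intros i z Hz; unfold in_disc in *. pose proof (rho_bounds i).
    rewrite Cmod_mult, Cmod_R, Rabs_pos_eq by lra. generalize (Cmod_ge_0 z); nra. }
  apply (bounded_limit_analytic (fun i z => F (RtoC (rho i) * phi z)%C) _ M HM).
  - intros i. pose proof (rho_bounds i) as Hi.
    (* For fixed [i] the sections are dominated by the sum of M (rho i)^k, hence the bound M / (1 -
       rho i). *)
    apply (bounded_limit_analytic
      (fun N z => Csum (fun k => (a k * (RtoC (rho i) * phi z) ^ k)%C) N) _ (M / (1 - rho i))).
    + apply Rdiv_le_0_compat; lra.
    + intros N. apply (Hinf_Csum (fun k z => (a k * (RtoC (rho i) * phi z) ^ k)%C)).
      intros k. apply Hinf_mult; [apply Hinf_const|].
      apply Hinf_pow, Hinf_mult; [apply Hinf_const|exact Hphi'].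
    + intros N z Hz. eapply Rle_trans; [apply Cmod_Csum|].
      apply Rle_trans with (sum_n (fun k => M * rho i ^ k) N).
      * apply sum_n_le_loc; intros k _. rewrite Cmod_mult, Cmod_pow.
        apply Rmult_le_compat; [apply Cmod_ge_0|apply pow_le, Cmod_ge_0|apply HaM|].
        apply pow_incr; split; [apply Cmod_ge_0|].
        rewrite Cmod_mult, Cmod_R, Rabs_pos_eq by lra.
        generalize (Hself z Hz); unfold in_disc; generalize (Cmod_ge_0 (phi z)); nra.
      * rewrite sum_n_scal. apply Rmult_le_compat_l; [exact HM|].
        assert (Hir : Rabs (rho i) < 1) by (rewrite Rabs_pos_eq; lra).
        rewrite <- (Series_geom (rho i) Hir).
        apply sum_n_le_Series; [intros; apply pow_le; lra|apply ex_series_geom, Hir].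
    + intros z Hz. apply (proj1 (has_coeffs_Ccv F a) Ha). apply Hdil, Hself, Hz.
  - intros i z Hz. apply HF, Hdil, Hself, Hz.
  - intros z Hz. apply (radial_continuity F a (phi z) Ha); [exists M; split; assumption|].
    apply Hself, Hz.
Qed.

(** * The weighted space *)

Lemma bweight_pos beta n : -1 < beta -> 0 < bweight beta n.
Proof.
  intros Hb; induction n as [|n IH]; [simpl; lra|].
  cbn [bweight]. assert (0 <= INR n) by apply pos_INR.
  apply Rmult_lt_0_compat; [exact IH|apply Rdiv_lt_0_compat; lra].
Qed.

Lemma bweight_decr beta n m : -1 < beta -> (n <= m)%nat -> bweight beta m <= bweight beta n.
Proof.
  intros Hb H; induction H as [|m H IH]; [apply Rle_refl|].
  eapply Rle_trans; [|exact IH]. cbn [bweight].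
  assert (0 <= INR m) by apply pos_INR.
  rewrite <- (Rmult_1_r (bweight beta m)) at 2.
  apply Rmult_le_compat_l; [apply Rlt_le, bweight_pos, Hb|].
  apply Rmult_le_reg_r with (INR m + 2 + beta); [lra|]. field_simplify; lra.
Qed.

(* If N (1 + beta) >= 1, Bernoulli's inequality bounds the N-th power of each factor
   (k+1)/(k+2+beta) by (k+1)/(k+2), and these telescope. *)
Lemma bweight_small beta delta : -1 < beta -> 0 < delta ->
  exists J, bweight beta J <= delta.
Proof.
  intros Hb Hd.
  destruct (nfloor_ex (/ (1 + beta))) as [N0 [_ HN0]].
  { apply Rlt_le, Rinv_0_lt_compat; lra. }
  (* [N0] is the integer part of 1 / (1 + beta), so adding one gives N (1 + beta) >= 1. *)
  set (N := S N0).
  assert (HN : 1 <= INR N * (1 + beta)).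
  { unfold N; rewrite S_INR. apply Rmult_le_reg_r with (/ (1 + beta)).
    - apply Rinv_0_lt_compat; lra.
    - rewrite Rmult_assoc, Rinv_r, Rmult_1_r, Rmult_1_l by lra. lra. }
  (* So the weight decays at least like (n + 1)^(-1/N). *)
  assert (Hw : forall n, bweight beta n ^ N * (INR n + 1) <= 1).
  { induction n as [|n IH]; [simpl bweight; rewrite pow1; simpl; lra|].
    assert (Hn : 0 <= INR n) by apply pos_INR.
    set (q := (INR n + 1) / (INR n + 2 + beta)).
    assert (Hq0 : 0 < q) by (apply Rdiv_lt_0_compat; lra).
    assert (Hq : q ^ N * (INR n + 2) <= INR n + 1).
    { assert (Hb' : 1 + INR N * ((1 + beta) / (INR n + 1)) <= (/ q) ^ N).
      { replace (/ q) with (1 + (1 + beta) / (INR n + 1)) by (unfold q; field; lra).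
        apply poly. apply Rdiv_lt_0_compat; lra. }
      assert (Hc : (INR n + 2) / (INR n + 1) <= (/ q) ^ N).
      { eapply Rle_trans; [|exact Hb'].
        replace ((INR n + 2) / (INR n + 1)) with (1 + 1 * / (INR n + 1)) by (field; lra).
        apply Rplus_le_compat_l. unfold Rdiv. rewrite <- Rmult_assoc.
        apply Rmult_le_compat_r; [apply Rlt_le, Rinv_0_lt_compat; lra|exact HN]. }
      rewrite pow_inv in Hc.
      assert (Hp : 0 < q ^ N) by (apply pow_lt, Hq0).
      apply (Rmult_le_compat_l (q ^ N * (INR n + 1))) in Hc;
        [|apply Rmult_le_pos; lra].
      replace (q ^ N * (INR n + 1) * ((INR n + 2) / (INR n + 1)))
        with (q ^ N * (INR n + 2)) in Hc by (field; lra).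
      replace (q ^ N * (INR n + 1) * / q ^ N) with (INR n + 1) in Hc by (field; lra).
      exact Hc. }
    cbn [bweight]. fold q. rewrite Rpow_mult_distr, S_INR.
    assert (0 < bweight beta n ^ N) by (apply pow_lt, bweight_pos, Hb).
    replace (INR n + 1 + 1) with (INR n + 2) by ring. nra. }
  assert (HdN : 0 < delta ^ N) by (apply pow_lt, Hd).
  destruct (nfloor_ex (/ delta ^ N)) as [J [_ HJ]].
  { apply Rlt_le, Rinv_0_lt_compat, HdN. }
  exists J. destruct (Rle_or_lt (bweight beta J) delta) as [H|H]; [exact H|exfalso].
  assert (H1 : delta ^ N <= bweight beta J ^ N) by (apply pow_incr; lra).
  assert (H2 : 1 < delta ^ N * (INR J + 1)).
  { apply (Rmult_lt_compat_l (delta ^ N)) in HJ; [|exact HdN].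
    rewrite Rinv_r in HJ by lra. exact HJ. }
  generalize (Hw J) (pos_INR J); nra.
Qed.

(** The squared norm is bounded through its partial sums, so no convergence has to be carried along
    and inequalities between sections apply directly. *)
Definition A2_sq_le (beta : R) (a : nat -> C) (B : R) : Prop :=
  forall n, sum_n (fun k => bweight beta k * Cmod (a k) ^ 2) n <= B.

Lemma sq_term_nonneg beta (a : nat -> C) k : -1 < beta -> 0 <= bweight beta k * Cmod (a k) ^ 2.
Proof.
  intros Hb; apply Rmult_le_pos; [apply Rlt_le, bweight_pos, Hb|apply pow2_ge_0].
Qed.

Lemma A2_sq_le_series beta a s : -1 < beta ->
  is_series (fun k => bweight beta k * Cmod (a k) ^ 2) s -> A2_sq_le beta a s.
Proof.
  intros Hb Hs n. rewrite <- (is_series_unique _ _ Hs).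
  apply sum_n_le_Series; [intros; apply sq_term_nonneg, Hb|exists s; exact Hs].
Qed.

Lemma in_A2_iff beta f : -1 < beta ->
  in_A2 beta f <-> exists a, has_coeffs f a /\ exists B, A2_sq_le beta a B.
Proof.
  intros Hb; split.
  - intros (a & Ha & s & Hs). exists a; split; [exact Ha|].
    exists s; apply A2_sq_le_series; assumption.
  - intros (a & Ha & B & HB). exists a; split; [exact Ha|].
    destruct (ex_series_bounded _ B (fun k => sq_term_nonneg beta a k Hb) HB) as (s & Hs & _).
    exists s; exact Hs.
Qed.

Lemma A2_dist_lt_intro beta g h a b B eps : -1 < beta ->
  has_coeffs g a -> has_coeffs h b -> A2_sq_le beta (fun k => (a k - b k)%C) B ->
  B < eps ^ 2 -> A2_dist_lt beta g h eps.
Proof.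
  intros Hb Ha Hb' HB HBe.
  destruct (ex_series_bounded _ B
    (fun k => sq_term_nonneg beta (fun k => (a k - b k)%C) k Hb) HB) as (s & Hs & HsB).
  exists a, b, s; repeat split; [exact Ha|exact Hb'|exact Hs|lra].
Qed.

Lemma weighted_sum_le beta (x y : nat -> R) n : -1 < beta ->
  (forall m, sum_n x m <= sum_n y m) ->
  sum_n (fun k => bweight beta k * x k) n <= sum_n (fun k => bweight beta k * y k) n.
Proof.
  intros Hb Hxy.
  (* The induction keeps the boundary term of the summation by parts; since the partial-sum
     difference is nonnegative, the decrease of the weight can only shrink that term at the next
     index. *)
  assert (H : bweight beta n * (sum_n y n - sum_n x n) <=
    sum_n (fun k => bweight beta k * y k) n - sum_n (fun k => bweight beta k * x k) n).
  { induction n as [|n IH].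
    - rewrite !sum_O. simpl; lra.
    - rewrite !sum_Sn. change plus with Rplus.
      generalize (Hxy n) (bweight_decr beta n (S n) Hb (le_S _ _ (le_n n))); intros. nra. }
  generalize (Hxy n) (bweight_pos beta n Hb); intros. nra.
Qed.

Lemma A2_sq_le_mult beta U u a M B : -1 < beta -> has_coeffs U u -> 0 <= M ->
  (forall z, in_disc z -> Cmod (U z) <= M) -> A2_sq_le beta a B ->
  A2_sq_le beta (conv u a) (M ^ 2 * B).
Proof.
  intros Hb Hu HM HU HB n.
  apply Rle_trans with (sum_n (fun k => bweight beta k * (M ^ 2 * Cmod (a k) ^ 2)) n).
  - apply (weighted_sum_le beta _ _ n Hb). intros m. rewrite sum_n_scal.
    apply (multiplier_section U u a M m Hu HM HU).
  - assert (E : forall k, bweight beta k * (M ^ 2 * Cmod (a k) ^ 2)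
      = M ^ 2 * (bweight beta k * Cmod (a k) ^ 2)) by (intros; ring).
    rewrite (sum_n_ext _ _ n E), sum_n_scal. apply Rmult_le_compat_l; [apply pow2_ge_0|apply HB].
Qed.

(** The termwise bound (x + y)^2 <= 2 x^2 + 2 y^2 stands in for the triangle inequality of the norm;
    the lost factor is absorbed wherever constants are chosen. *)
Lemma A2_sq_le_plus beta a b A B : -1 < beta -> A2_sq_le beta a A -> A2_sq_le beta b B ->
  A2_sq_le beta (fun k => (a k + b k)%C) (2 * A + 2 * B).
Proof.
  intros Hb HA HB n.
  apply Rle_trans with (sum_n (fun k => plus (2 * (bweight beta k * Cmod (a k) ^ 2))
     (2 * (bweight beta k * Cmod (b k) ^ 2))) n).
  - apply sum_n_le_loc; intros k _. change plus with Rplus.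
    pose proof (bweight_pos beta k Hb) as Hw.
    generalize (Cmod_triangle (a k) (b k)) (Cmod_ge_0 (a k + b k)%C)
      (Cmod_ge_0 (a k)) (Cmod_ge_0 (b k)); intros.
    assert (Cmod (a k + b k)%C ^ 2 <= 2 * Cmod (a k) ^ 2 + 2 * Cmod (b k) ^ 2).
    { generalize (pow2_ge_0 (Cmod (a k) - Cmod (b k))); nra. }
    nra.
  - rewrite sum_n_plus, !sum_n_scal. change plus with Rplus.
    generalize (HA n) (HB n); lra.
Qed.

Lemma A2_sq_le_ext beta a b B : (forall k, a k = b k) -> A2_sq_le beta a B -> A2_sq_le beta b B.
Proof.
  intros E H n. rewrite (sum_n_ext _ (fun k => bweight beta k * Cmod (a k) ^ 2));
    [apply H|intros; rewrite E; reflexivity].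
Qed.

Lemma A2_sq_le_opp beta a B : A2_sq_le beta a B -> A2_sq_le beta (fun k => (- (1) * a k)%C) B.
Proof.
  intros H n. rewrite (sum_n_ext _ (fun k => bweight beta k * Cmod (a k) ^ 2));
    [apply H|intros; rewrite Cmod_mult, Cmod_m1, Rmult_1_l; reflexivity].
Qed.

Lemma A2_tail_small beta a B eta : -1 < beta -> A2_sq_le beta a B -> 0 < eta ->
  exists K, A2_sq_le beta (fun k => (a k - truncate K a k)%C) eta.
Proof.
  intros Hb HB He. set (x := fun k => bweight beta k * Cmod (a k) ^ 2).
  assert (Hx : forall k, 0 <= x k) by (intros; apply sq_term_nonneg, Hb).
  destruct (ex_series_bounded x B Hx HB) as (s & Hs & _).
  assert (Hlim : is_lim_seq (sum_n x) s) by exact Hs.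
  apply is_lim_seq_spec in Hlim. destruct (Hlim (mkposreal eta He)) as [K HK].
  specialize (HK K (le_n K)). simpl in HK. exists K; intros n.
  assert (Hle : sum_n (fun k => bweight beta k * Cmod (a k - truncate K a k)%C ^ 2) n
                <= sum_n x (max n K) - sum_n x K).
  { induction n as [|n IH].
    - rewrite sum_O, Nat.max_0_l. unfold truncate; destruct (le_dec 0 K); [|lia].
      unfold Cminus; rewrite Cplus_opp_r, Cmod_0. lra.
    - rewrite sum_Sn. change plus with Rplus. unfold truncate at 2.
      destruct (le_dec (S n) K) as [Hn|Hn].
      + unfold Cminus at 2; rewrite Cplus_opp_r, Cmod_0.
        rewrite Nat.max_r in * by lia. lra.
      + rewrite Nat.max_l in * by lia. rewrite sum_Sn. change plus with Rplus.
        unfold x at 2. replace (a (S n) - 0)%C with (a (S n)) by ring. lra. }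
  eapply Rle_trans; [exact Hle|].
  assert (Hmax : sum_n x (max n K) <= s) by (apply A2_sq_le_series; assumption).
  apply Rabs_lt_between in HK. lra.
Qed.

(** Beyond an index J the weight is at most [bweight beta J], which is small, and multiplies a Hardy
    sum of at most M^2; the J + 1 remaining coefficients are small by [coeffs_null], with weights at
    most 1. *)
Lemma Hinf_null_A2 beta (U : nat -> C -> C) M eps : -1 < beta -> 0 <= M ->
  (forall n z, in_disc z -> Cmod (U n z) <= M) ->
  (forall z, in_disc z -> Ccv (fun n => U n z) 0) -> 0 < eps ->
  exists N, forall n, (N <= n)%nat ->
    forall u, has_coeffs (U n) u -> A2_sq_le beta u eps.
Proof.
  intros Hb HM HU Hlim He.
  destruct (bweight_small beta (eps / 2 / (M ^ 2 + 1)) Hb) as [J HJ].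
  { apply Rdiv_lt_0_compat; [lra|generalize (pow2_ge_0 M); lra]. }
  (* The cap at 1 gives eta^2 <= eta, so the J + 1 low terms contribute at most eps / 2. *)
  set (eta := Rmin 1 (eps / 2 / INR (S J))).
  assert (HSJ : 0 < INR (S J)) by (apply lt_0_INR; lia).
  assert (Heta : 0 < eta) by (apply Rmin_glb_lt; [lra|apply Rdiv_lt_0_compat; lra]).
  assert (Heta2 : INR (S J) * eta ^ 2 <= eps / 2).
  { assert (eta <= 1) by apply Rmin_l.
    assert (eta <= eps / 2 / INR (S J)) by apply Rmin_r.
    apply Rle_trans with (INR (S J) * (eps / 2 / INR (S J))); [|apply Req_le; field; lra].
    apply Rmult_le_compat_l; [lra|]. nra. }
  destruct (coeffs_null U M eta (S J) HM HU Hlim Heta) as [N HN].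
  exists N; intros n Hn u Hu m.
  specialize (HN n Hn u Hu).
  set (low := fun k => if le_dec k J then eta ^ 2 else 0).
  apply Rle_trans with (sum_n (fun k => plus (low k) (bweight beta J * Cmod (u k) ^ 2)) m).
  - apply sum_n_le_loc; intros k _. change plus with Rplus. unfold low.
    pose proof (bweight_pos beta k Hb). pose proof (bweight_pos beta J Hb).
    pose proof (pow2_ge_0 (Cmod (u k))).
    destruct (le_dec k J) as [Hk|Hk].
    + assert (bweight beta k <= 1) by (apply (bweight_decr beta 0 k Hb); lia).
      assert (Cmod (u k) ^ 2 <= eta ^ 2)
        by (apply pow_incr; split; [apply Cmod_ge_0|apply HN; lia]).
      nra.
    + assert (bweight beta k <= bweight beta J) by (apply bweight_decr; [exact Hb|lia]).
      nra.
  - rewrite sum_n_plus, sum_n_scal. change plus with Rplus.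
    assert (Hlow : sum_n low m <= INR (S J) * eta ^ 2).
    { apply Rle_trans with (sum_n low (max m J)).
      - apply sum_n_incr; [|lia]. intros k; unfold low.
        destruct (le_dec k J); [apply pow2_ge_0|lra].
      - assert (HJm : (J <= max m J)%nat) by lia.
        induction HJm as [|L HL IH].
        + rewrite <- sum_n_const. apply sum_n_le_loc; intros k Hk; unfold low.
          destruct (le_dec k J); [lra|lia].
        + rewrite sum_Sn. change plus with Rplus. unfold low at 2.
          destruct (le_dec (S L) J); [lia|lra]. }
    assert (Hhigh : bweight beta J * sum_n (fun k => Cmod (u k) ^ 2) m <= eps / 2).
    { apply Rle_trans with (eps / 2 / (M ^ 2 + 1) * (M ^ 2 + 1)).
      - pose proof (pow2_ge_0 M).
        apply Rmult_le_compat.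
        + apply Rlt_le, bweight_pos, Hb.
        + apply sum_n_nonneg; intros; apply pow2_ge_0.
        + exact HJ.
        + generalize (hardy_section _ _ _ m Hu HM (HU n)); lra.
      - apply Req_le; field. generalize (pow2_ge_0 M); lra. }
    lra.
Qed.

Lemma Csum_shift a n : Csum a (S n) = (a O + Csum (fun k => a (S k)) n)%C.
Proof.
  induction n as [|n IH].
  - rewrite Csum_S, !Csum_0; reflexivity.
  - rewrite Csum_S, IH, (Csum_S (fun k => a (S k))). ring.
Qed.

Lemma Csum_rev (a : nat -> C) n : Csum (fun k => a (n - k)%nat) n = Csum a n.
Proof.
  induction n as [|n IH]; [rewrite !Csum_0; reflexivity|].
  rewrite Csum_shift, Csum_S, <- IH, Nat.sub_0_r, Cplus_comm. reflexivity.
Qed.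

Lemma conv_comm a b n : conv a b n = conv b a n.
Proof.
  unfold conv. rewrite <- Csum_rev. apply Csum_ext_loc; intros k Hk.
  replace (n - (n - k))%nat with k by lia. ring.
Qed.

(* Multiplication by a bounded null sequence of Hinf is strongly null on A^2_beta: split
   f into a polynomial, on which Hinf_null_A2 applies, and a remainder of small norm. *)
Lemma A2_mult_null beta a B (U : nat -> C -> C) M eps : -1 < beta ->
  A2_sq_le beta a B -> 0 <= M ->
  (forall n z, in_disc z -> Cmod (U n z) <= M) ->
  (forall z, in_disc z -> Ccv (fun n => U n z) 0) -> 0 < eps ->
  exists N, forall n, (N <= n)%nat ->
    forall u, has_coeffs (U n) u -> A2_sq_le beta (conv u a) eps.
Proof.
  intros Hb Ha HM HU Hlim He.
  assert (HMp : 0 < M ^ 2 + 1) by (generalize (pow2_ge_0 M); lra).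
  (* The remainder and the polynomial part each get eps / 4, which [A2_sq_le_plus] doubles; the
     [+ 1] avoids dividing by zero. *)
  destruct (A2_tail_small beta a B (eps / 4 / (M ^ 2 + 1)) Hb Ha) as [K HK].
  { apply Rdiv_lt_0_compat; lra. }
  set (A := sum_n (fun k => Cmod (a k)) K).
  assert (HA : 0 <= A) by (apply sum_n_nonneg; intros; apply Cmod_ge_0).
  assert (HAp : 0 < A ^ 2 + 1) by (generalize (pow2_ge_0 A); lra).
  destruct (Hinf_null_A2 beta U M (eps / 4 / (A ^ 2 + 1)) Hb HM HU Hlim) as [N HN].
  { apply Rdiv_lt_0_compat; lra. }
  exists N; intros n Hn u Hu. specialize (HN n Hn u Hu).
  apply (A2_sq_le_ext beta (fun k => (conv (truncate K a) u k +
    conv u (fun k => a k - truncate K a k) k)%C)).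
  { intros k. rewrite conv_comm. unfold conv. rewrite <- Csum_plus.
    apply Csum_ext_loc; intros; ring. }
  (* The roles are exchanged here: the polynomial, bounded by [A] on the disc, is the multiplier,
     acting on U_n, which is itself small in norm. *)
  assert (H1 : A2_sq_le beta (conv (truncate K a) u) (A ^ 2 * (eps / 4 / (A ^ 2 + 1)))).
  { apply (A2_sq_le_mult beta _ _ _ _ _ Hb (has_coeffs_truncate K a) HA); [|exact HN].
    intros z Hz. eapply Rle_trans; [apply Cmod_Csum|].
    apply sum_n_le_loc; intros k _. rewrite Cmod_mult, Cmod_pow.
    assert (0 <= Cmod z ^ k <= 1).
    { split; [apply pow_le, Cmod_ge_0|]. rewrite <- (pow1 k).
      apply pow_incr; split; [apply Cmod_ge_0|apply Rlt_le, Hz]. }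
    generalize (Cmod_ge_0 (a k)); nra. }
  assert (H2 := A2_sq_le_mult beta _ _ _ _ _ Hb Hu HM (HU n) HK).
  assert (frac : forall x, 0 <= x -> x * (eps / 4 / (x + 1)) <= eps / 4).
  { intros x Hx. apply Rmult_le_reg_r with (x + 1); [lra|]. field_simplify; [nra|lra]. }
  intros m. eapply Rle_trans; [apply (A2_sq_le_plus beta _ _ _ _ Hb H1 H2)|].
  generalize (frac (A ^ 2) (pow2_ge_0 A)) (frac (M ^ 2) (pow2_ge_0 M)). lra.
Qed.

(** * Point evaluations and the absence of zeros of cyclic functions *)

(** By the ratio test: the quotient of consecutive terms is r (1 + (1 + beta) / (k + 1)), written
    with [1 - rho k] = 1 / (k + 1), and tends to r. *)
Lemma inv_bweight_summable beta r : -1 < beta -> 0 < r < 1 ->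
  ex_series (fun k => r ^ k / bweight beta k).
Proof.
  intros Hb Hr.
  assert (Hpos : forall k, 0 < r ^ k / bweight beta k)
    by (intros k; apply Rdiv_lt_0_compat; [apply pow_lt; lra|apply bweight_pos, Hb]).
  apply ex_series_ext with (fun k => Rabs (r ^ k / bweight beta k)).
  { intros k; apply Rabs_pos_eq, Rlt_le, Hpos. }
  apply ex_series_DAlembert with r; [lra| |].
  - intros k; generalize (Hpos k); lra.
  - apply is_lim_seq_ext with (fun k => r + r * (1 + beta) * (1 - rho k)).
    + intros k. rewrite Rabs_pos_eq by (apply Rlt_le, Rdiv_lt_0_compat; apply Hpos).
      cbn [bweight pow]. unfold rho. pose proof (pos_INR k).
      pose proof (bweight_pos beta k Hb). pose proof (pow_lt r k (proj1 Hr)).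
      field. repeat split; lra.
    + replace (Finite r) with (Finite (r + r * (1 + beta) * (1 - 1))) by (f_equal; ring).
      apply is_lim_seq_plus'; [apply is_lim_seq_const|].
      apply is_lim_seq_mult'; [apply is_lim_seq_const|].
      apply is_lim_seq_minus'; [apply is_lim_seq_const|].
      apply is_lim_seq_ext with (2 := rho_pow_lim 1). intros; simpl; ring.
Qed.

(** In place of Cauchy-Schwarz, each term satisfies D q <= w D^2 / t + t q^2 / w, with w the weight;
    the sums are at most t and t S, with S depending on z only. *)
Lemma point_evaluation beta z : -1 < beta -> in_disc z ->
  exists S, 0 <= S /\ forall G d t, has_coeffs G d -> 0 < t -> A2_sq_le beta d (t ^ 2) ->
    Cmod (G z) <= t * (1 + S).
Proof.
  intros Hb Hz. pose proof (Cmod_ge_0 z) as Hz0. unfold in_disc in Hz.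
  set (r := (1 + Cmod z) / 2).
  assert (Hr : 0 < r < 1 /\ Cmod z <= r) by (unfold r; lra).
  pose proof (inv_bweight_summable beta r Hb (proj1 Hr)) as Hsum.
  set (x := fun k => r ^ k / bweight beta k) in *.
  assert (Hx : forall k, 0 <= x k).
  { intros k; apply Rlt_le, Rdiv_lt_0_compat; [apply pow_lt; lra|apply bweight_pos, Hb]. }
  exists (Series x). split.
  { eapply Rle_trans; [|apply (sum_n_le_Series x 0 Hx Hsum)]. rewrite sum_O; apply Hx. }
  intros G d t Hd Ht HB.
  apply (Ccv_bound (Csum (fun k => (d k * z ^ k)%C)) _ _ 0).
  { apply (proj1 (has_coeffs_Ccv G d) Hd z Hz). }
  intros n _. eapply Rle_trans; [apply Cmod_Csum|].
  apply Rle_trans with (sum_n (fun k => plus (/ t * (bweight beta k * Cmod (d k) ^ 2))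
    (t * x k)) n).
  - apply sum_n_le_loc; intros k _. change plus with Rplus.
    rewrite Cmod_mult, Cmod_pow. unfold x.
    pose proof (bweight_pos beta k Hb) as Hw. set (w := bweight beta k) in *.
    set (D := Cmod (d k)). assert (HD : 0 <= D) by apply Cmod_ge_0.
    assert (Hrk : 0 < r ^ k) by (apply pow_lt; lra).
    assert (Hrk1 : r ^ k <= 1) by (rewrite <- (pow1 k); apply pow_incr; lra).
    apply Rle_trans with (D * r ^ k).
    { apply Rmult_le_compat_l; [exact HD|]. apply pow_incr; lra. }
    set (q := r ^ k) in *.
    (* Clearing denominators leaves (w D)(t q) <= (w D)^2 + (t q)^2; then q^2 <= q, as q <= 1,
       brings back the summable majorant. *)
    apply Rle_trans with (/ t * (w * D ^ 2) + t * (q ^ 2 / w)).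
    + apply Rmult_le_reg_l with (t * w); [apply Rmult_lt_0_compat; lra|].
      replace (t * w * (/ t * (w * D ^ 2) + t * (q ^ 2 / w)))
        with ((w * D) ^ 2 + (t * q) ^ 2) by (field; lra).
      assert (0 <= (w * D) * (t * q)) by (repeat apply Rmult_le_pos; lra).
      generalize (pow2_ge_0 (w * D - t * q)). nra.
    + apply Rplus_le_compat_l, Rmult_le_compat_l; [lra|].
      apply Rmult_le_compat_r; [apply Rlt_le, Rinv_0_lt_compat, Hw|]. nra.
  - rewrite sum_n_plus, !sum_n_scal. change plus with Rplus.
    assert (H1 : / t * sum_n (fun k => bweight beta k * Cmod (d k) ^ 2) n <= t).
    { apply Rle_trans with (/ t * t ^ 2); [|apply Req_le; field; lra].
      apply Rmult_le_compat_l; [apply Rlt_le, Rinv_0_lt_compat, Ht|apply HB]. }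
    generalize (Rmult_le_compat_l t _ _ (Rlt_le _ _ Ht) (sum_n_le_Series x n Hx Hsum)). lra.
Qed.

Lemma A2_dist_lt_elim beta g h eps : -1 < beta -> A2_dist_lt beta g h eps ->
  exists a b s, has_coeffs g a /\ has_coeffs h b /\
    A2_sq_le beta (fun k => (a k - b k)%C) s /\ s < eps ^ 2.
Proof.
  intros Hb (a & b & s & Ha & Hb' & Hs & Hlt). exists a, b, s.
  repeat split; try assumption. apply A2_sq_le_series; assumption.
Qed.

Lemma in_A2_const beta c : -1 < beta -> in_A2 beta (fun _ => c).
Proof.
  intros Hb. apply in_A2_iff; [exact Hb|].
  eexists; split; [apply has_coeffs_const|]. exists (Cmod c ^ 2).
  intros n. induction n as [|n IH].
  - rewrite sum_O. change (1 * Cmod c ^ 2 <= Cmod c ^ 2). lra.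
  - rewrite sum_Sn. change plus with Rplus.
    assert (E : truncate 0 (fun _ => c) (S n) = RtoC 0) by reflexivity.
    rewrite E, Cmod_0. nra.
Qed.

(** Every multiple p f vanishes at a zero of f, whereas approximating the constant 1 in norm forces
    values near 1 there. *)
Lemma cyclic_nonvanishing beta f z : -1 < beta -> cyclic_A2 beta f -> in_disc z ->
  f z <> RtoC 0.
Proof.
  intros Hb [_ Hcyc] Hz Hf.
  destruct (point_evaluation beta z Hb Hz) as (S & HS & Hev).
  (* Makes [t * (1 + S)] equal to 1/2, too small for the distance between the values 0 and 1. *)
  set (t := / (2 * (1 + S))).
  assert (Ht : 0 < t) by (apply Rinv_0_lt_compat; lra).
  destruct (Hcyc (fun _ => RtoC 1) (in_A2_const beta 1 Hb) t Ht) as [p Hp].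
  apply A2_dist_lt_elim in Hp; [|exact Hb]. destruct Hp as (a & b & s & Ha & Hb' & Hs & Hlt).
  assert (HG : has_coeffs (fun z => (peval p z * f z + - (1) * RtoC 1)%C)
                 (fun k => (a k - b k)%C)).
  { apply has_coeffs_ext with
      (1 := has_coeffs_plus _ _ _ _ Ha (has_coeffs_scal (- (1)) _ _ Hb')).
    - reflexivity.
    - intros; ring. }
  assert (H1 := Hev _ _ t HG Ht (fun n => Rle_trans _ _ _ (Hs n) (Rlt_le _ _ Hlt))).
  cbv beta in H1. rewrite Hf in H1.
  replace (peval p z * 0 + - (1) * 1)%C with (- (1))%C in H1 by ring.
  rewrite Cmod_m1 in H1.
  replace (t * (1 + S)) with (1 / 2) in H1 by (unfold t; field; lra). lra.
Qed.

(** * Polynomials along the orbits of phi, and density of the range *)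

Lemma Hinf_peval p : Hinf (peval p).
Proof.
  induction p as [|c p IH]; [exact (Hinf_const 0)|].
  exact (Hinf_plus _ _ (Hinf_const c) (Hinf_mult _ _ Hinf_id IH)).
Qed.

Lemma Ccv_mult u v l m : Ccv u l -> Ccv v m -> Ccv (fun n => (u n * v n)%C) (l * m)%C.
Proof.
  rewrite !Ccv_Re_Im. intros [Hu1 Hu2] [Hv1 Hv2]; split.
  - apply (is_lim_seq_minus' _ _ _ _ (is_lim_seq_mult' _ _ _ _ Hu1 Hv1)
      (is_lim_seq_mult' _ _ _ _ Hu2 Hv2)).
  - apply (is_lim_seq_plus' _ _ _ _ (is_lim_seq_mult' _ _ _ _ Hu1 Hv2)
      (is_lim_seq_mult' _ _ _ _ Hu2 Hv1)).
Qed.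

Lemma Ccv_pow u l n : Ccv u l -> Ccv (fun i => (u i ^ n)%C) (l ^ n)%C.
Proof.
  intros Hu; induction n as [|n IH]; [exact (Ccv_const 1)|]. apply (Ccv_mult _ _ _ _ Hu IH).
Qed.

Lemma Ccv_peval p u l : Ccv u l -> Ccv (fun i => peval p (u i)) (peval p l).
Proof.
  intros Hu; induction p as [|c p IH]; [exact (Ccv_const 0)|].
  apply (Ccv_plus _ _ _ _ (Ccv_const c) (Ccv_mult _ _ _ _ Hu IH)).
Qed.

Lemma iter_selfmap phi k z : analytic_selfmap phi -> in_disc z -> in_disc (Nat.iter k phi z).
Proof.
  intros [_ H] Hz; induction k as [|k IH]; [exact Hz|apply H, IH].
Qed.

(** Peeling off the innermost application of phi turns each further iterate into a composition with
    phi on the right, where [Hinf_comp] applies. *)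
Lemma Hinf_comp_iter P phi k : Hinf P -> analytic_selfmap phi ->
  Hinf (fun z => P (Nat.iter k phi z)).
Proof.
  intros HP Hphi; induction k as [|k IH]; [exact HP|].
  destruct (Hinf_comp _ _ IH Hphi) as [[u Hu] (M & HM0 & HM)]. split.
  - exists u; apply has_coeffs_ext with (1 := Hu); [|reflexivity].
    intros z _; rewrite Nat.iter_succ_r; reflexivity.
  - exists M; split; [exact HM0|]. intros z Hz; rewrite Nat.iter_succ_r; apply HM, Hz.
Qed.

Lemma Csum_telescope (q : nat -> C) n :
  (Csum (fun k => q (S k)) n - Csum q n = q (S n) - q O)%C.
Proof.
  assert (H := Csum_shift q n). rewrite Csum_S in H.
  replace (Csum (fun k => q (S k)) n) with (Csum q n + q (S n) - q O)%C
    by (rewrite H; ring). ring.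
Qed.

Lemma in_A2_mult beta f U : -1 < beta -> in_A2 beta f -> Hinf U ->
  in_A2 beta (fun z => (U z * f z)%C).
Proof.
  intros Hb Hf [[u Hu] (M & HM0 & HM)].
  apply in_A2_iff in Hf; [|exact Hb]. destruct Hf as (a & Ha & B & HB).
  apply in_A2_iff; [exact Hb|]. exists (conv u a). split; [apply has_coeffs_mult; assumption|].
  exists (M ^ 2 * B). apply (A2_sq_le_mult beta U u a M B); assumption.
Qed.

Theorem theorem2p3 (beta : R) (phi : C -> C) (omega lambda : C) (f : C -> C) :
  -1 < beta ->
  analytic_selfmap phi ->
  DW_point phi omega -> Cmod omega = 1 ->
  (* f is an eigenvector of C_phi on A^2_beta for lambda, and f is cyclic *)
  in_A2 beta f ->
  (exists z, in_disc z /\ f z <> RtoC 0) ->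
  (forall z, in_disc z -> f (phi z) = (lambda * f z)%C) ->
  cyclic_A2 beta f ->
  (* C_phi - lambda I has dense range in A^2_beta *)
  forall h, in_A2 beta h -> forall eps, 0 < eps ->
    exists g, in_A2 beta g /\
      A2_dist_lt beta (fun z => (g (phi z) - lambda * g z)%C) h eps.
Proof.
  intros Hb Hphi HDW Homega Hf _ Heig Hcyc h Hh eps Heps.
  assert (Hdisc0 : in_disc (RtoC 0)) by (unfold in_disc; rewrite Cmod_0; lra).
  assert (Hlambda : lambda <> RtoC 0).
  { intros E. apply (cyclic_nonvanishing beta f (phi (RtoC 0)) Hb Hcyc).
    - apply (proj2 Hphi), Hdisc0.
    - rewrite Heig, E by exact Hdisc0. ring. }
  (* Error budget: p f is within eps/2 of h, so s < eps^2/4; the two null terms have squared norm at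
     most eps^2/16 each, and 2 s + 2 (2 + 2) eps^2/16 < eps^2. *)
  assert (Heps2 : 0 < eps ^ 2 / 16) by (apply Rdiv_lt_0_compat; [apply pow_lt|]; lra).
  assert (Heps' : 0 < eps / 2) by lra.
  destruct (proj2 Hcyc h Hh (eps / 2) Heps') as [p Hp].
  apply A2_dist_lt_elim in Hp; [|exact Hb]. destruct Hp as (a & b & s & Ha & Hb' & Hs & Hlt).
  destruct (proj1 (in_A2_iff beta f Hb) Hf) as (af & Haf & B & HB).
  destruct (Hinf_peval p) as [_ (Mp & HMp0 & HMp)].
  set (v := fun n z => (peval p z * (Cconj omega * z) ^ n)%C).
  assert (Hv : forall n, Hinf (v n)).
  { intros n. apply Hinf_mult; [apply Hinf_peval|].
    apply (Hinf_pow (fun z => Cconj omega * z)%C), Hinf_mult; [apply Hinf_const|apply Hinf_id]. }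
  assert (Hvmod : forall n z, in_disc z -> Cmod (v n z) <= Mp * Cmod z ^ n).
  { intros n z Hz. unfold v. rewrite Cmod_mult, Cmod_pow, Cmod_mult, Cmod_conj, Homega, Rmult_1_l.
    apply Rmult_le_compat_r; [apply pow_le, Cmod_ge_0|apply HMp, Hz]. }
  destruct (A2_mult_null beta af B v Mp (eps ^ 2 / 16) Hb HB HMp0) as [n Hn].
  { intros n z Hz. eapply Rle_trans; [apply Hvmod, Hz|].
    assert (Cmod z ^ n <= 1).
    { rewrite <- (pow1 n). apply pow_incr; split; [apply Cmod_ge_0|apply Rlt_le, Hz]. }
    nra. }
  { intros z Hz. apply Ccv_squeeze with (fun n => Mp * Cmod z ^ n); [|apply Ccv_null_geom, Hz].
    intros n. replace (v n z - 0)%C with (v n z) by ring. apply Hvmod, Hz. }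
  { exact Heps2. }
  destruct (proj1 (Hv n)) as [u1 Hu1]. specialize (Hn n (le_n n) u1 Hu1).
  set (P := fun z => (peval p z + - (1) * v n z)%C).
  assert (HP : Hinf P).
  { apply Hinf_plus; [apply Hinf_peval|apply Hinf_mult; [apply Hinf_const|apply Hv]]. }
  (* Since conj(omega) omega = |omega|^2 = 1, the two summands of [P] cancel at omega. *)
  assert (HPomega : P omega = RtoC 0).
  { unfold P, v. rewrite (Cmult_comm (Cconj omega)), <- Cmod2_conj, Homega, pow1, Cpow_1_l. ring. }
  set (q := fun k z => P (Nat.iter k phi z)).
  assert (Hq : forall k, Hinf (q k)) by (intros k; apply Hinf_comp_iter; assumption).
  destruct HP as [_ (MP & HMP0 & HMP)].
  destruct (A2_mult_null beta af B q MP (eps ^ 2 / 16) Hb HB HMP0) as [m Hm].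
  { intros k z Hz. apply HMP, iter_selfmap; assumption. }
  (* [P] is a polynomial, hence continuous at the boundary point omega, so its values along an orbit
     tend to P(omega). *)
  { intros z Hz. rewrite <- HPomega.
    assert (Hit : Ccv (fun k => Nat.iter k phi z) omega) by apply Ccv_filterlim, HDW, Hz.
    unfold q, P, v. apply Ccv_plus; [apply Ccv_peval, Hit|].
    apply Ccv_scal, Ccv_mult; [apply Ccv_peval, Hit|].
    apply (Ccv_pow (fun k => Cconj omega * Nat.iter k phi z)%C), Ccv_scal, Hit. }
  { exact Heps2. }
  (* The index is [S m] because the differences for q_0, ..., q_m telescope to q_(m+1) - q_0. *)
  destruct (proj1 (Hq (S m))) as [u2 Hu2].
  specialize (Hm (S m) (le_S _ _ (le_n m)) u2 Hu2).
  set (Q := fun z => Csum (fun k => q k z) m).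
  (* With g = -(1/lambda) Q f, the eigenvalue equation gives C_phi g - lambda g = f (Q - Q o phi) =
     f (q_0 - q_(m+1)), and f q_0 = p f - v_n f. *)
  exists (fun z => (- / lambda * Q z * f z)%C). split.
  { apply in_A2_mult; [exact Hb|exact Hf|].
    apply (Hinf_mult (fun _ => - / lambda)%C Q); [apply Hinf_const|].
    apply Hinf_Csum, Hq. }
  (* Coefficients of p f - v_n f - q_(m+1) f. *)
  set (c := fun k => (a k + (- (1) * conv u1 af k + - (1) * conv u2 af k))%C).
  apply (A2_dist_lt_intro beta _ _ c b (2 * s + 2 * (2 * (eps ^ 2 / 16) + 2 * (eps ^ 2 / 16))) eps Hb).
  - apply has_coeffs_ext with (1 := has_coeffs_plus _ _ _ _ Ha (has_coeffs_plus _ _ _ _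
      (has_coeffs_scal (- (1)) _ _ (has_coeffs_mult _ _ _ _ Hu1 Haf))
      (has_coeffs_scal (- (1)) _ _ (has_coeffs_mult _ _ _ _ Hu2 Haf)))); [|reflexivity].
    intros z Hz. rewrite Heig by exact Hz.
    assert (EQ : Q (phi z) = (Q z + q (S m) z - q O z)%C).
    { unfold Q. rewrite (Csum_ext_loc (fun k => q k (phi z)) (fun k => q (S k) z)).
      - replace (Csum (fun k => q (S k) z) m)
          with ((Csum (fun k => q (S k) z) m - Csum (fun k => q k z) m)
                + Csum (fun k => q k z) m)%C by ring.
        rewrite (Csum_telescope (fun k => q k z)). ring.
      - intros k _; unfold q. rewrite Nat.iter_succ_r; reflexivity. }
    rewrite EQ. change (q O z) with (peval p z + - (1) * v n z)%C.
    field. exact Hlambda.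
  - exact Hb'.
  - apply (A2_sq_le_ext beta (fun k => ((a k - b k) +
      (- (1) * conv u1 af k + - (1) * conv u2 af k))%C)).
    { intros k; unfold c; ring. }
    apply A2_sq_le_plus; [exact Hb|exact Hs|].
    apply A2_sq_le_plus; [exact Hb| |]; apply A2_sq_le_opp; assumption.
  - replace ((eps / 2) ^ 2) with (eps ^ 2 / 4) in Hlt by field. lra.
Qed.
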